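(* Let $a,d,c$ be positive integers and $k\ge2$ an integer with $\gcd(a,a+d,\ldots,a+kd,c)=1$, and let $\mathcal{S}=\langle a,a+d,\ldots,a+kd,c\rangle$. Then $\mathcal{S}$ is pseudo-symmetric if and only if $\gcd(a,d)=1$ and one of the following holds: (a) $\mathcal{S}=\langle 3,3+d,3+2d\rangle$ (as sets); (b) $a(c-1)=2(c+d)$ and $c$ is odd; (c) $s_v\equiv3\pmod k$, $s_{v+1}=1$, $P_{v+1}=P_v+1$ and $R_v=3$; (d) $s_v\equiv1\pmod k$, $s_{v+1}=2k-1$, $P_{v+1}=P_v+1$ and $R_v=1$; (e) $s_0\equiv2\pmod k$, $s_0=s_1+1$ and $R_1=1-2k$; (f) $s_0\equiv2\pmod k$, $s_0=s_1+3$ and $R_1=-1$.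
   Context: $\langle b_1,\ldots,b_t\rangle$ denotes the numerical semigroup of non-negative integer combinations of $b_1,\ldots,b_t$. For a numerical semigroup $\mathcal{S}$ with Frobenius number $g$ (largest integer not in $\mathcal{S}$), $\mathcal{S}$ is pseudo-symmetric if $g$ is even and $\mathcal{S}\cup(g-\mathcal{S})=\mathbb{Z}\setminus\{g/2\}$, where $g-\mathcal{S}=\{g-s:s\in\mathcal{S}\}$. When $\gcd(a,d)=1$ the following quantities are defined. Put $s_{-1}=a$ and let $s_0$ be the unique integer with $ds_0\equiv c\pmod a$, $0\le s_0<a$. If $s_0=0$ set $m=-1$. Otherwise define $q_{i+1},s_{i+1}$ for $i=0,1,2,\ldots$ by $s_{i-1}=q_{i+1}s_i-s_{i+1}$ with $0\le s_{i+1}<s_i$, and let $m$ be the index with $s_m>0=s_{m+1}$ (so $s_m=\gcd(a,c)$). Define $P_{-1}=0$, $P_0=1$, $P_{i+1}=q_{i+1}P_i-P_{i-1}$ for $i=0,\ldots,m$, and $R_i=\frac1a\big((a+kd)s_i-kcP_i\big)$ for $-1\le i\le m+1$; these are integers with $-c/s_m=R_{m+1}<R_m<\cdots<R_0<R_{-1}=a+kd$. Let $v$ be the unique integer with $R_{v+1}\le0<R_v$. (Here $s_1,R_1$ refer to these sequences; when they are not defined, e.g. $m<0$, the corresponding condition is understood to fail.) *)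

(* Defs.v *)
From Stdlib Require Import ZArith List.
Import ListNotations.
Open Scope Z_scope.

Definition gens (a d c k : Z) : list Z :=
  map (fun i => a + Z.of_nat i * d) (seq 0 (S (Z.to_nat k))) ++ [c].

Definition gcd_list (l : list Z) : Z := fold_right Z.gcd 0 l.

Inductive InSG (G : list Z) : Z -> Prop :=
| InSG0 : InSG G 0
| InSG_add : forall g x, In g G -> InSG G x -> InSG G (g + x).

Definition is_frobenius (G : list Z) (g : Z) : Prop :=
  ~ InSG G g /\ forall x, g < x -> InSG G x.

Definition pseudo_symmetric (G : list Z) : Prop :=
  exists g, is_frobenius G g /\ Z.Even g /\
    forall z, (InSG G z \/ (exists s, InSG G s /\ z = g - s)) <-> z <> g / 2.

(* s_0 : the unique integer with d*s_0 ≡ c (mod a), 0 <= s_0 < a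
   (found by search; meaningful when gcd(a,d)=1). *)
Definition s0 (a d c : Z) : Z :=
  match find (fun t => Z.eqb ((d * t - c) mod a) 0)
              (map Z.of_nat (seq 0 (Z.to_nat a))) with
  | Some t => t
  | None => 0
  end.

(* st n = (s_{n-1}, s_n, P_{n-1}, P_n), following
   s_{i-1} = q_{i+1} s_i - s_{i+1}, 0 <= s_{i+1} < s_i  (so q_{i+1} = ceil(s_{i-1}/s_i)),
   P_{i+1} = q_{i+1} P_i - P_{i-1}.  Values past termination (s_i = 0) are junk
   and never used. *)
Fixpoint st (a d c : Z) (n : nat) : Z * Z * Z * Z :=
  match n with
  | O => (a, s0 a d c, 0, 1)
  | S n' =>
      let '(x, y, p, q) := st a d c n' in
      if Z.eqb y 0 then (0, 0, q, q)
      else let qq := - ((- x) / y) in (y, qq * y - x, q, qq * q - p)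
  end.

(* s_i and P_i for i >= -1 *)
Definition s_ (a d c : Z) (i : Z) : Z :=
  let '(x, _, _, _) := st a d c (Z.to_nat (i + 1)) in x.
Definition P_ (a d c : Z) (i : Z) : Z :=
  let '(_, _, p, _) := st a d c (Z.to_nat (i + 1)) in p.

Definition R_ (a d c k : Z) (i : Z) : Z :=
  ((a + k * d) * s_ a d c i - k * c * P_ a d c i) / a.

(* Main.v *)
Require Import Defs.
From Stdlib Require Import ZArith List Lia Znumtheory Classical.
Import ListNotations.
Open Scope Z_scope.

(** Put [A = a], [B = a + k d], [C = k c].  An element [n a + j d + y c] of the semigroup is
    [1/k] times [h A + j B + y C] with [h = k n - j >= 0], so the semigroup is the part of
    degree [0 mod k] of the semigroup generated by [A], [B], [C] when these have degrees
    [1, 1, 0].  With [(s, t, p, q) = (s_v, s_{v+1}, P_v, P_{v+1})], [R = R_v > 0] and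
    [T = - R_{v+1} >= 0], all relations between [A], [B], [C] are generated by
    [s B = R A + p C] and [q C = t B + T A].  Hence every integer has a unique form
    [h A + j B + y C] with [(j, y)] in an L-shaped region, and the gaps are exactly the
    integers lying below one of the two outer corners of the L.  Taking degrees into account,
    the maximal gaps are among two arithmetic progressions of step [-d], with [r1 + 1] and
    [r2 + 1] terms.

    Pseudo-symmetry asks that the Frobenius number [g] and [g/2] be in these progressions and
    that [g - x] be in the semigroup for each other term [x].  If [g - d] is a gap then
    [g = 2d], which leads to (a) and (b).  Otherwise [g] is one corner, [g/2] belongs to the
    progression of the other, and the membership conditions become inequalities between
    [s - t], [T] (or [t], [R]) and the index; the equation [2 (g/2) = g] is then a relation
    between [A], [B], [C] whose coordinates on the two basic relations are forced, giving
    (c)-(f). *)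

(** * The semigroup in coordinates *)

(** [n] counts the generators taken from the arithmetic progression and [j] the copies of [d] they
    carry together. *)
Definition SG (a d c k x : Z) : Prop :=
  exists n j y, 0 <= j <= k * n /\ 0 <= y /\ x = n * a + j * d + y * c.

Lemma SG_intro (a d c k n j y : Z) :
  0 <= j <= k * n -> 0 <= y -> SG a d c k (n * a + j * d + y * c).
Proof. intros; exists n, j, y; auto. Qed.

Lemma SG_eq (a d c k x y : Z) : SG a d c k x -> x = y -> SG a d c k y.
Proof. intros H <-. exact H. Qed.

Lemma SG_add (a d c k x y : Z) :
  SG a d c k x -> SG a d c k y -> SG a d c k (x + y).
Proof.
  intros (n & j & u & H1 & H2 & ->) (n' & j' & u' & H1' & H2' & ->).
  exists (n + n'), (j + j'), (u + u'). split; [lia | split; [lia | ring]].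
Qed.

Lemma SG_0 (a d c k : Z) : SG a d c k 0.
Proof. exists 0, 0, 0. lia. Qed.

Lemma SG_c (a d c k : Z) : SG a d c k c.
Proof. exists 0, 0, 1. lia. Qed.

Lemma SG_nonneg (a d c k x : Z) :
  0 < a -> 0 < d -> 0 < c -> 0 < k -> SG a d c k x -> 0 <= x.
Proof. intros ? ? ? ? (n & j & y & H1 & H2 & ->). assert (0 <= n) by nia. nia. Qed.

Lemma InSG_add (G : list Z) (x y : Z) : InSG G x -> InSG G y -> InSG G (x + y).
Proof.
  induction 1 as [|g x Hg Hx IH]; intros Hy; [exact Hy|].
  rewrite <- Z.add_assoc. constructor; auto.
Qed.

Lemma in_gens (a d c k g : Z) : 0 <= k ->
  In g (gens a d c k) <-> (exists i, 0 <= i <= k /\ g = a + i * d) \/ g = c.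
Proof.
  intros Hk. unfold gens. rewrite in_app_iff, in_map_iff. split.
  - intros [(i & <- & Hi) | [<- | []]]; [left | right; reflexivity].
    apply in_seq in Hi. exists (Z.of_nat i). lia.
  - intros [(i & Hi & ->) | ->]; [left | right; left; reflexivity].
    exists (Z.to_nat i). split; [rewrite Z2Nat.id by lia; reflexivity | apply in_seq; lia].
Qed.

Lemma InSG_gens (a d c k x : Z) : 2 <= k -> InSG (gens a d c k) x <-> SG a d c k x.
Proof.
  intros Hk. split.
  - induction 1 as [|g x Hg Hx IH]; [apply SG_0|].
    apply SG_add; [|exact IH].
    apply in_gens in Hg as [(i & Hi & ->) | ->]; [|apply SG_c|lia].
    exists 1, i, 0. lia.
  - intros (n & j & y & Hj & Hy & ->). apply InSG_add.
    + assert (Hn : 0 <= n) by nia. revert j Hj. pattern n. apply natlike_ind; [| |exact Hn].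
      * intros j Hj. replace j with 0 by lia. constructor.
      * intros m Hm IH j Hj.
        (* One generator is split off that carries only what the other [m] cannot hold. *)
        replace (Z.succ m * a + j * d)
          with ((a + (j - Z.min j (k * m)) * d) + (m * a + Z.min j (k * m) * d)) by ring.
        constructor; [apply in_gens; [lia|left; eexists; split; [|reflexivity]; nia]|].
        apply IH. nia.
    + pattern y. apply natlike_ind; [constructor| |exact Hy].
      intros m Hm IH. replace (Z.succ m * c) with (c + m * c) by ring.
      constructor; [apply in_gens; [lia|right; reflexivity] | exact IH].
Qed.

(** * Pseudo-symmetry through half the Frobenius number, and gluing *)

(* [h] is half of the Frobenius number. *)
Definition PSym (S : Z -> Prop) (h : Z) : Prop :=
  ~ S (2 * h) /\ (forall x, 2 * h < x -> S x) /\
  forall z, (S z \/ S (2 * h - z)) <-> z <> h.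

Lemma pseudo_symmetric_iff (G : list Z) (S : Z -> Prop) :
  (forall x, InSG G x <-> S x) -> pseudo_symmetric G <-> exists h, PSym S h.
Proof.
  intros HS. unfold pseudo_symmetric, is_frobenius, PSym. split.
  - intros (g & [Hg Hx] & [h Hh] & Hz). exists h. subst g.
    rewrite HS in Hg. split; [exact Hg|]. split; [intros; apply HS; auto|].
    intros z. replace h with (2 * h / 2) at 2 by (rewrite Z.mul_comm; apply Z.div_mul; lia).
    rewrite <- Hz. rewrite HS. apply or_iff_compat_l. split.
    + intros H. exists (2 * h - z). rewrite HS. split; [exact H | lia].
    + intros (s & Hs & ->). rewrite HS in Hs. replace (2 * h - (2 * h - s)) with s by lia. exact Hs.
  - intros (h & Hg & Hx & Hz). exists (2 * h). rewrite HS.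
    split; [split; [exact Hg|intros; apply HS; auto]|]. split; [exists h; reflexivity|].
    intros z. replace (2 * h / 2) with h by (rewrite Z.mul_comm; symmetry; apply Z.div_mul; lia).
    rewrite <- Hz, HS. apply or_iff_compat_l. split.
    + intros (s & Hs & ->). rewrite HS in Hs. replace (2 * h - (2 * h - s)) with s by lia. exact Hs.
    + intros H. exists (2 * h - z). rewrite HS. split; [exact H | lia].
Qed.

Lemma gcd_list_divides (l : list Z) (e : Z) :
  (forall g, In g l -> (e | g)) -> (e | gcd_list l).
Proof.
  induction l as [|g l IH]; intros H; simpl; [apply Z.divide_0_r|].
  apply Z.gcd_greatest; [apply H; left; reflexivity | apply IH; intros; apply H; right; assumption].
Qed.

Lemma gens_common_divisor (a d c k e : Z) : 0 <= k ->
  gcd_list (gens a d c k) = 1 -> (e | a) -> (e | d) -> (e | c) -> (e | 1).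
Proof.
  intros Hk Hg Ha Hd Hc. rewrite <- Hg. apply gcd_list_divides. intros g Hin.
  apply in_gens in Hin as [(i & Hi & ->) | ->]; [|exact Hc|exact Hk].
  apply Z.divide_add_r; [exact Ha|apply Z.divide_mul_r; exact Hd].
Qed.

(* The semigroup is [e S' + c {0, ..., e - 1}], and [h] pairs with itself under [z -> 2h - z];
   changing the coefficient of [c] in [h] yields a second unpaired integer. *)
Lemma glued_not_PSym (S : Z -> Prop) (e c h : Z) :
  (forall x y, S x -> S y -> S (x + y)) -> S 0 -> S c -> 0 < c ->
  2 <= e -> Z.gcd e c = 1 ->
  (forall x, S x -> exists t y, S t /\ (e | t) /\ 0 <= y /\ x = t + y * c) ->
  ~ PSym S h.
Proof.
  intros Sadd S0 Sc cpos He Hec Hdec (Hg & Hx & Hz).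
  assert (Smul : forall m, 0 <= m -> S (m * c)).
  { intros m Hm. pattern m. apply natlike_ind; [exact S0| |exact Hm].
    intros y Hy IH. replace (Z.succ y * c) with (c + y * c) by ring. auto. }
  (* Coefficients of [c] agree modulo [e], so a coefficient below [e] is the least possible one; the
     excess is a multiple of [e] and stays with [x]. *)
  assert (Hcancel : forall x y, (e | x) -> 0 <= y < e -> S (x + y * c) -> S x).
  { intros x y [x' ->] Hy HS.
    destruct (Hdec _ HS) as (t & y' & Ht & [t' ->] & Hy' & E).
    assert (Hd : (e | y' - y)).
    { apply (Z.gauss _ c); [exists (x' - t'); lia | exact Hec]. }
    destruct Hd as [r Hr]. assert (0 <= r) by nia.
    replace (x' * e) with (t' * e + (r * e) * c) by nia.
    apply Sadd; [exact Ht | apply Smul; nia]. }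
  assert (Hh : ~ S h) by (intros H; apply (proj1 (Hz h)); auto).
  destruct (Z.gcd_bezout e c 1 Hec) as (u & w & Huw).
  (* [w] inverts [c] modulo [e], which makes [h - y0 * c] a multiple of [e]. *)
  set (y0 := (w * h) mod e). set (x0 := h - y0 * c).
  pose proof (Z.mod_pos_bound (w * h) e ltac:(lia)) as Hy0. fold y0 in Hy0.
  assert (Hx0 : (e | x0)).
  { pose proof (Z.div_mod (w * h) e ltac:(lia)) as Hdm. fold y0 in Hdm.
    exists (u * h + (w * h / e) * c). unfold x0.
    transitivity (h * (u * e + w * c) - y0 * c); [rewrite Huw; ring|].
    transitivity (h * u * e + (e * (w * h / e) + y0) * c - y0 * c); [|ring].
    rewrite <- Hdm. ring. }
  assert (Eh : h = x0 + y0 * c) by (unfold x0; ring).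
  assert (Hx0S : ~ S x0).
  { intros H. apply Hh. rewrite Eh. apply Sadd; [exact H | apply Smul; lia]. }
  (* For [y0 = e - 1], cancelling in [2 * h + c] would put [2 * h] in [S]; otherwise pairing [h + c]
     would put [h] in [S]. *)
  destruct (Z.eq_dec y0 (e - 1)) as [Ey | Ny].
  - assert (H1 : S (2 * h + c)) by (apply Hx; lia).
    replace (2 * h + c) with ((2 * x0 + e * c) + (e - 1) * c) in H1 by nia.
    apply Hcancel in H1; [| |lia].
    + apply Hg. replace (2 * h) with ((2 * x0 + e * c) + (e - 2) * c) by nia.
      apply Sadd; [exact H1 | apply Smul; lia].
    + apply Z.divide_add_r; [apply Z.divide_mul_r; exact Hx0 | apply Z.divide_factor_l].
  - destruct (proj2 (Hz (h + c)) ltac:(lia)) as [H | H].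
    + apply Hx0S, (Hcancel x0 (y0 + 1)); [exact Hx0 | lia|].
      replace (x0 + (y0 + 1) * c) with (h + c) by lia. exact H.
    + apply Hh. replace h with ((2 * h - (h + c)) + c) by lia. apply Sadd; assumption.
Qed.

(** * Normal forms modulo the two basic relations *)

(* [D] and [E] are the integers with [R = s + k * D] and [- T = t + k * E]; in terms of
   [A = a], [B = a + k * d], [C = k * c] the fields say [s B = R A + p C] and [q C = t B + T A]. *)
Record herzog_basis (a d c k s t p q D E : Z) : Prop := {
  hb_s : 0 <= t < s;
  hb_p : 0 <= p < q;
  hb_det : s * q - t * p = a;
  hb_D : d * s - c * p = a * D;
  hb_E : d * t - c * q = a * E;
  hb_R : 0 < s + k * D;
  hb_T : t + k * E <= 0;
  hb_coprime : Z.gcd a d = 1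
}.

Lemma hb_a_pos (a d c k s t p q D E : Z) : herzog_basis a d c k s t p q D E -> 0 < a.
Proof. intros [? ? <- _ _ _ _ _]. nia. Qed.

(** Cramer's rule with determinant [a]: [x] and [y] are [(u q + w t) / a] and [(u p + w s) / a].
    Both numerators are divisible by [a] because [d] times them is and [d] is prime to [a]. *)
Lemma hb_lattice (a d c k s t p q D E n u w : Z) :
  herzog_basis a d c k s t p q D E ->
  n * a + u * d + w * c = 0 ->
  exists x y, u = x * s - y * t /\ w = y * q - x * p /\ n = y * E - x * D.
Proof.
  intros HB H. pose proof (hb_a_pos _ _ _ _ _ _ _ _ _ _ HB) as Ha.
  destruct HB as [_ _ Hdet HD HE _ _ Hg].
  assert (Hx : (a | u * q + w * t)).
  { apply (Z.gauss _ d); [exists (w * E - n * q)|exact Hg].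
    transitivity ((n * a + u * d + w * c) * q + w * (d * t - c * q) - n * q * a); [ring|].
    rewrite H, HE. ring. }
  assert (Hy : (a | u * p + w * s)).
  { apply (Z.gauss _ d); [exists (w * D - n * p)|exact Hg].
    transitivity ((n * a + u * d + w * c) * p + w * (d * s - c * p) - n * p * a); [ring|].
    rewrite H, HD. ring. }
  destruct Hx as [x Hx], Hy as [y Hy].
  assert (Eu : u = x * s - y * t).
  { apply (Z.mul_reg_l _ _ a); [lia|].
    transitivity ((x * a) * s - (y * a) * t); [|ring]. rewrite <- Hx, <- Hy, <- Hdet. ring. }
  assert (Ew : w = y * q - x * p).
  { apply (Z.mul_reg_l _ _ a); [lia|].
    transitivity ((y * a) * q - (x * a) * p); [|ring]. rewrite <- Hx, <- Hy, <- Hdet. ring. }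
  exists x, y. split; [exact Eu|]. split; [exact Ew|].
  apply (Z.mul_reg_l _ _ a); [lia|].
  transitivity (y * (a * E) - x * (a * D)); [|ring].
  rewrite <- HD, <- HE. rewrite Eu, Ew in H. lia.
Qed.

(* The last conclusion says that the coefficient [k * n - i] of [A] drops by [x * R + z * T] and
   stays nonnegative. *)
Lemma hb_compare (a d c k s t p q D E n i y : Z) :
  herzog_basis a d c k s t p q D E ->
  SG a d c k (n * a + i * d + y * c) ->
  exists x z, 0 <= i + x * s - z * t /\ 0 <= y + z * q - x * p /\
    x * (s + k * D) - z * (t + k * E) <= k * n - i.
Proof.
  intros HB (n' & i' & y' & Hi & Hy & Eq).
  destruct (hb_lattice _ _ _ _ _ _ _ _ _ _ (n' - n) (i' - i) (y' - y) HB ltac:(lia))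
    as (x & z & E1 & E2 & E3).
  exists x, z. split; [lia|]. split; [lia|].
  assert (k * (n' - n) = k * (z * E - x * D)) by (rewrite E3; ring). lia.
Qed.

(** Starting inside the L-shape, a combination of the relations keeps both coefficients nonnegative
    only if [x] and [z] are nonnegative, and then the left side of the inequality in [hb_compare] is
    nonnegative. *)
Lemma hb_not_in (a d c k s t p q D E n i y : Z) :
  herzog_basis a d c k s t p q D E ->
  (i < s /\ y < q - p) \/ (i < s - t /\ y < q) ->
  SG a d c k (n * a + i * d + y * c) -> i <= k * n.
Proof.
  intros HB HL HS.
  destruct (hb_compare _ _ _ _ _ _ _ _ _ _ _ _ _ HB HS) as (x & z & H1 & H2 & H3).
  destruct HB as [Hs Hp _ _ _ HR HT _].
  set (R := s + k * D) in *. set (T := t + k * E) in *.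
  assert (0 <= x).
  { apply Z.nlt_ge. intros Hx. assert (z < 0) by nia.
    destruct (Z.lt_trichotomy x z) as [L | [L | L]].
    - assert (x * s - z * t <= - s) by nia. lia.
    - subst z. assert (x * s - x * t <= - (s - t)) by nia.
      assert (x * q - x * p <= - (q - p)) by nia. lia.
    - assert (z * q - x * p <= - q) by nia. lia. }
  assert (0 <= z).
  { apply Z.nlt_ge. intros Hz. assert (z * q - x * p <= - q) by nia. lia. }
  nia.
Qed.

(* The weight [(p + q) * i + (s + t) * y] drops by [a] along each basic relation. *)
Lemma hb_descent (a d c k s t p q D E : Z) :
  herzog_basis a d c k s t p q D E ->
  forall M n i y, 0 <= M -> (p + q) * i + (s + t) * y <= M -> 0 <= i -> 0 <= y ->
  exists n' i' y', n' * a + i' * d + y' * c = n * a + i * d + y * c /\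
    0 <= i' /\ 0 <= y' /\ ((i' < s /\ y' < q - p) \/ (i' < s - t /\ y' < q)).
Proof.
  intros HB M n i y HM. revert n i y. pattern M. apply Zlt_0_ind; [|exact HM].
  clear M HM. intros M IH HM n i y Hle Hi Hy.
  pose proof (hb_a_pos _ _ _ _ _ _ _ _ _ _ HB) as Ha.
  destruct HB as [Hs Hp Hdet HD HE _ _ _].
  destruct (Z_lt_le_dec i s) as [L1 | G1].
  - destruct (Z_lt_le_dec y q) as [L2 | G2].
    + destruct (Z_lt_le_dec y (q - p)) as [L3 | G3]; [exists n, i, y; lia|].
      destruct (Z_lt_le_dec i (s - t)) as [L4 | G4]; [exists n, i, y; lia|].
      (* In the notch of the L neither relation applies alone, but their sum does. *)
      destruct (IH (M - 2 * a)) with (n := n + (D - E)) (i := i - (s - t)) (y := y - (q - p))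
        as (n' & i' & y' & Eq & HH); [nia | nia | lia | lia|].
      exists n', i', y'. split; [rewrite Eq; lia | exact HH].
    + destruct (IH (M - a)) with (n := n - E) (i := i + t) (y := y - q)
        as (n' & i' & y' & Eq & HH); [nia | nia | lia | lia|].
      exists n', i', y'. split; [rewrite Eq; lia | exact HH].
  - destruct (IH (M - a)) with (n := n + D) (i := i - s) (y := y + p)
      as (n' & i' & y' & Eq & HH); [nia | nia | lia | lia|].
    exists n', i', y'. split; [rewrite Eq; lia | exact HH].
Qed.

Lemma hb_represent (a d c k s t p q D E z : Z) :
  herzog_basis a d c k s t p q D E ->
  exists n i y, z = n * a + i * d + y * c /\
    0 <= i /\ 0 <= y /\ ((i < s /\ y < q - p) \/ (i < s - t /\ y < q)).
Proof.
  intros HB. pose proof (hb_a_pos _ _ _ _ _ _ _ _ _ _ HB) as Ha.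
  destruct (Z.gcd_bezout a d 1 (hb_coprime _ _ _ _ _ _ _ _ _ _ HB)) as (u & w & Huw).
  pose proof (Z.div_mod (z * w) a ltac:(lia)) as Hdm.
  pose proof (Z.mod_pos_bound (z * w) a ltac:(lia)) as Hb.
  pose proof (hb_s _ _ _ _ _ _ _ _ _ _ HB). pose proof (hb_p _ _ _ _ _ _ _ _ _ _ HB).
  set (i0 := (z * w) mod a) in *. set (m := z * w / a) in *.
  destruct (hb_descent _ _ _ _ _ _ _ _ _ _ HB ((p + q) * i0) (z * u + m * d) i0 0)
    as (n & i & y & Eq & HH); [nia | nia | lia | lia|].
  exists n, i, y. split; [|exact HH]. rewrite Eq.
  transitivity (z * (u * a + w * d)); [rewrite Huw; ring|].
  transitivity (z * u * a + (z * w) * d); [ring | rewrite Hdm; ring].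
Qed.

(** * Maximal gaps at the two corners *)

(** [k n < i <= e] forces [n <= m]. The choice [j = min r (e - i)] lowers the remaining number of
    copies of [d] to what [m - n] generators can carry. *)
Lemma corner_dominates (a d c k e m r f n i y : Z) :
  0 < k -> e - 1 = k * m + r -> 0 <= r < k -> i <= e -> y <= f -> k * n < i ->
  exists j, 0 <= j <= r /\
    SG a d c k (m * a + (e - j) * d + f * c - (n * a + i * d + y * c)).
Proof.
  intros Hk He Hr Hi Hy Hn.
  assert (n <= m) by nia. assert (k * n <= k * m) by nia.
  exists (Z.min r (e - i)). split; [lia|].
  exists (m - n), (e - Z.min r (e - i) - i), (f - y).
  split; [lia | split; [lia | ring]].
Qed.

(** No gap exceeds [2 h]. A gap [x] in [X] with [x - h] in [S] and [x <> h] would have [2 h - x] in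
    [S], and the sum of both would be [h]. *)
Lemma PSym_generators (S X : Z -> Prop) (h : Z) :
  (forall x y, S x -> S y -> S (x + y)) -> (forall x, S x -> 0 <= x) ->
  (forall z, ~ S z -> exists x, X x /\ S (x - z)) -> (forall x, X x -> ~ S x) ->
  PSym S h -> X (2 * h) /\ X h.
Proof.
  intros Sadd Spos Hgap HX (Hg & Hx & Hz). split.
  - destruct (Hgap _ Hg) as (x & HXx & HS). pose proof (Spos _ HS).
    replace (2 * h) with x; [exact HXx|].
    destruct (Z_lt_le_dec (2 * h) x) as [L|]; [destruct (HX _ HXx (Hx _ L)) | lia].
  - assert (Hh : ~ S h) by (intros H; apply (proj1 (Hz h)); auto).
    destruct (Hgap _ Hh) as (x & HXx & HS).
    destruct (Z.eq_dec x h) as [<- | Ne]; [exact HXx|].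
    destruct (proj2 (Hz x) Ne) as [H | H]; [destruct (HX _ HXx H)|].
    destruct Hh. replace h with ((2 * h - x) + (x - h)) by lia. auto.
Qed.

(** Pairing passes from [x] down to [z] by [2 h - z = (2 h - x) + (x - z)]. If [z] and [2 h - z]
    both lie below [h], then [h - z] and [z - h] are both nonnegative. *)
Lemma PSym_of_generators (S X : Z -> Prop) (h : Z) :
  (forall x y, S x -> S y -> S (x + y)) -> (forall x, S x -> 0 <= x) ->
  (forall z, ~ S z -> exists x, X x /\ S (x - z)) ->
  (forall x, X x -> S (2 * h - x) \/ x = h) ->
  ~ S (2 * h) -> ~ S h -> 0 < h -> PSym S h.
Proof.
  intros Sadd Spos Hgap HX Hg Hh hpos. split; [exact Hg|]. split.
  - intros x Hx. apply NNPP. intros Hn. destruct (Hgap _ Hn) as (y & HXy & HS).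
    pose proof (Spos _ HS). destruct (HX _ HXy) as [H1 | H1]; [|lia].
    pose proof (Spos _ H1). lia.
  - intros z. split.
    + intros [H | H] ->; [auto|]. apply Hh. replace h with (2 * h - h) by lia. exact H.
    + intros Ne. apply NNPP. intros Hn. apply not_or_and in Hn as [Hn1 Hn2].
      destruct (Hgap _ Hn1) as (x & HXx & HS). destruct (HX _ HXx) as [H1 | ->].
      * apply Hn2. replace (2 * h - z) with ((2 * h - x) + (x - z)) by lia. auto.
      * destruct (Hgap _ Hn2) as (y & HXy & HS'). destruct (HX _ HXy) as [H1 | ->].
        -- apply Hh. replace h with ((2 * h - y) + ((y - (2 * h - z)) + (h - z))) by lia. auto.
        -- pose proof (Spos _ HS). pose proof (Spos _ HS'). lia.
Qed.

(* The gaps attached to the outer corner [(e, f)] of the L-shape, for [0 <= j <= (e - 1) mod k]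
   and [m = (e - 1) / k]. *)
Definition corner (a d c m e f j : Z) : Z := m * a + (e - j) * d + f * c.

Record corner_data (k s t m1 r1 m2 r2 : Z) : Prop := {
  cd_1 : s - 2 = k * m1 + r1;
  cd_r1 : 0 <= r1 < k;
  cd_2 : s - t - 2 = k * m2 + r2;
  cd_r2 : 0 <= r2 < k
}.

Lemma corner_data_exist (k s t : Z) : 0 < k -> exists m1 r1 m2 r2, corner_data k s t m1 r1 m2 r2.
Proof.
  intros Hk. exists ((s - 2) / k), ((s - 2) mod k), ((s - t - 2) / k), ((s - t - 2) mod k).
  split; try (apply Z.div_mod; lia); apply Z.mod_pos_bound; lia.
Qed.

Lemma corner1_gap (a d c k s t p q D E m1 r1 m2 r2 j : Z) :
  herzog_basis a d c k s t p q D E -> corner_data k s t m1 r1 m2 r2 ->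
  0 <= j <= r1 -> ~ SG a d c k (corner a d c m1 (s - 1) (q - p - 1) j).
Proof.
  intros HB [H1 _ _ _] Hj HS.
  apply (hb_not_in _ _ _ _ _ _ _ _ _ _ _ _ _ HB) in HS; [lia | left; lia].
Qed.

Lemma corner2_gap (a d c k s t p q D E m1 r1 m2 r2 j : Z) :
  herzog_basis a d c k s t p q D E -> corner_data k s t m1 r1 m2 r2 ->
  0 <= j <= r2 -> ~ SG a d c k (corner a d c m2 (s - t - 1) (q - 1) j).
Proof.
  intros HB [_ _ H2 _] Hj HS.
  apply (hb_not_in _ _ _ _ _ _ _ _ _ _ _ _ _ HB) in HS; [lia | right; lia].
Qed.

(** For [p = 0] or [t = 0] the L is a rectangle with a single corner. The two forms of the
    conclusion drop the redundant corner, and together they later yield [0 < p] and [0 < t]. *)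
Lemma gap_below_corner (a d c k s t p q D E m1 r1 m2 r2 z : Z) :
  0 < k -> herzog_basis a d c k s t p q D E -> corner_data k s t m1 r1 m2 r2 ->
  ~ SG a d c k z ->
  let X1 := exists j, 0 <= j <= r1 /\ SG a d c k (corner a d c m1 (s - 1) (q - p - 1) j - z) in
  let X2 := exists j, 0 <= j <= r2 /\ SG a d c k (corner a d c m2 (s - t - 1) (q - 1) j - z) in
  (X1 \/ 0 < p /\ X2) /\ (0 < t /\ X1 \/ X2).
Proof.
  intros Hk HB [H1 Hr1 H2 Hr2] Hz X1 X2.
  destruct (hb_represent _ _ _ _ _ _ _ _ _ _ z HB) as (n & i & y & -> & Hi & Hy & HL).
  assert (Hn : k * n < i).
  { apply Z.nle_gt. intros Hle. apply Hz. apply SG_intro; lia. }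
  pose proof (hb_s _ _ _ _ _ _ _ _ _ _ HB). pose proof (hb_p _ _ _ _ _ _ _ _ _ _ HB).
  assert (C1 : i < s -> y < q - p -> X1) by (intros; apply corner_dominates; lia).
  assert (C2 : i < s - t -> y < q -> X2) by (intros; apply corner_dominates; lia).
  split.
  - destruct (Z_lt_le_dec y (q - p)); [left; apply C1; lia | right; split; [lia | apply C2; lia]].
  - destruct (Z_lt_le_dec i (s - t)); [right; apply C2; lia | left; split; [lia | apply C1; lia]].
Qed.

(** * Coprimality of [a] and [d], and the case of Frobenius number [2 d] *)

Lemma SG_multiple_of_a (a d c k n : Z) : 0 <= k -> 0 <= n -> SG a d c k (n * a).
Proof. intros. exists n, 0, 0. split; [split; [lia | apply Z.mul_nonneg_nonneg; lia] | split; [lia | ring]]. Qed.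

(** For [a = 1] the Frobenius number would be [-1], which is odd. *)
Lemma PSym_a_gt_1 (a d c k h : Z) :
  0 < a -> 0 < d -> 0 < c -> 2 <= k -> PSym (SG a d c k) h -> 1 < a.
Proof.
  intros Ha Hd Hc Hk (Hg & Hx & _).
  destruct (Z.eq_dec a 1) as [-> | ]; [exfalso | lia].
  destruct (Z_lt_le_dec (2 * h) (-1)) as [L | L].
  - apply Hx, SG_nonneg in L; lia.
  - apply Hg. replace (2 * h) with (2 * h * 1) by lia. apply SG_multiple_of_a; lia.
Qed.

Lemma PSym_coprime (a d c k h : Z) :
  0 < a -> 0 < d -> 0 < c -> 2 <= k -> gcd_list (gens a d c k) = 1 ->
  PSym (SG a d c k) h -> Z.gcd a d = 1.
Proof.
  intros Ha Hd Hc Hk Hg HP.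
  pose proof (Z.gcd_nonneg a d). assert (Z.gcd a d <> 0) by (intros H0; apply Z.gcd_eq_0 in H0; lia).
  destruct (Z.eq_dec (Z.gcd a d) 1) as [|Ne]; [assumption|exfalso].
  pose proof (Z.gcd_divide_l a d) as Ga. pose proof (Z.gcd_divide_r a d) as Gd.
  refine (glued_not_PSym _ (Z.gcd a d) c h (SG_add _ _ _ _) (SG_0 _ _ _ _) (SG_c _ _ _ _) Hc _ _ _ HP).
  - lia.
  - pose proof (Z.gcd_divide_l (Z.gcd a d) c) as G1. pose proof (Z.gcd_divide_r (Z.gcd a d) c) as G2.
    pose proof (gens_common_divisor a d c k (Z.gcd (Z.gcd a d) c) ltac:(lia) Hg
      (Z.divide_trans _ _ _ G1 Ga) (Z.divide_trans _ _ _ G1 Gd) G2) as G.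
    apply Z.divide_1_r_nonneg; [apply Z.gcd_nonneg | exact G].
  - intros x (n & j & y & Hj & Hy & ->). exists (n * a + j * d), y.
    split; [exists n, j, 0; lia|]. split; [|lia].
    apply Z.divide_add_r; apply Z.divide_mul_r; assumption.
Qed.

(* If [d] lies in the semigroup then the semigroup is [<a, c>], which is symmetric. *)
Lemma PSym_d_gap (a d c k h : Z) :
  0 < a -> 0 < d -> 0 < c -> 2 <= k -> gcd_list (gens a d c k) = 1 ->
  PSym (SG a d c k) h -> ~ SG a d c k d.
Proof.
  intros Ha Hd Hc Hk Hg HP (n & j & y & Hj & Hy & Ed).
  assert (Hn : 0 <= n) by nia.
  assert (j = 0).
  { destruct (Z.eq_dec j 0) as [| Nj]; [assumption | exfalso].
    assert (0 < n) by nia. assert (d <= j * d) by nia. nia. }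
  subst j.
  pose proof (PSym_a_gt_1 _ _ _ _ _ Ha Hd Hc Hk HP).
  refine (glued_not_PSym _ a c h (SG_add _ _ _ _) (SG_0 _ _ _ _) (SG_c _ _ _ _) Hc _ _ _ HP).
  - lia.
  - pose proof (Z.gcd_divide_l a c) as G1. pose proof (Z.gcd_divide_r a c) as G2.
    assert (G3 : (Z.gcd a c | d)).
    { rewrite Ed. rewrite Z.mul_0_l, Z.add_0_r.
      apply Z.divide_add_r; apply Z.divide_mul_r; assumption. }
    pose proof (gens_common_divisor a d c k (Z.gcd a c) ltac:(lia) Hg G1 G3 G2) as G.
    apply Z.divide_1_r_nonneg; [apply Z.gcd_nonneg | exact G].
  - intros x (n' & j' & y' & Hj' & Hy' & ->). assert (0 <= n') by nia.
    exists ((n' + j' * n) * a), (y' + j' * y).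
    split; [apply SG_multiple_of_a; nia|]. split; [apply Z.divide_factor_r|].
    split; [nia|]. rewrite Ed at 1. ring.
Qed.

(** Eliminating [c] turns [3 d] in the semigroup into [(3 - J) d = N a], so [a] divides a positive
    number at most [3]; [a = 2] would put [2 d] in the semigroup. *)
Lemma redundant_c_case (a d c k n j : Z) :
  0 < a -> 0 < d -> 0 < c -> 2 <= k -> Z.gcd a d = 1 ->
  1 < a -> ~ SG a d c k d -> ~ SG a d c k (2 * d) -> SG a d c k (3 * d) ->
  0 <= j <= k * n -> c = n * a + j * d ->
  forall x, SG a d c k x <-> SG 3 d 3 2 x.
Proof.
  intros Ha Hd Hc Hk Hg Ha1 Nd N2d H3d Hj Ec.
  assert (Hn : 0 <= n) by nia.
  assert (Ha3 : a = 3).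
  { destruct H3d as (n' & j' & y' & Hj' & Hy' & E3).
    assert (Hn' : 0 <= n') by nia.
    set (N := n' + y' * n). set (J := j' + y' * j).
    assert (HN : 0 <= N) by (unfold N; nia).
    assert (HJ : 0 <= J <= k * N) by (unfold N, J; nia).
    assert (EJ : (3 - J) * d = N * a) by (unfold N, J; rewrite Ec in E3; lia).
    assert (HJ3 : 0 < 3 - J).
    { destruct (Z.eq_dec N 0) as [E0 | ]; [rewrite E0 in HJ; lia | nia]. }
    assert (Hdiv : (a | 3 - J)).
    { apply (Z.gauss _ d); [exists N; lia | exact Hg]. }
    pose proof (Z.divide_pos_le _ _ HJ3 Hdiv).
    destruct (Z.eq_dec a 2) as [E2 | ]; [exfalso | lia].
    apply N2d. rewrite E2, (Z.mul_comm 2 d). apply SG_multiple_of_a; lia. }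
  clear Nd N2d H3d. subst a. intros x. split.
  - intros (n' & j' & y' & Hj' & Hy' & ->). rewrite Ec.
    assert (Hn' : 0 <= n') by nia.
    set (N := n' + y' * n). set (J := j' + y' * j).
    assert (HN : 0 <= N) by (unfold N; nia).
    assert (HJ : 0 <= J <= k * N) by (unfold N, J; nia).
    replace (n' * 3 + j' * d + y' * (n * 3 + j * d)) with (N * 3 + J * d) by (unfold N, J; ring).
    pose proof (Z.div_mod J 3 ltac:(lia)). pose proof (Z.mod_pos_bound J 3 ltac:(lia)).
    assert (0 <= J / 3) by (apply Z.div_pos; lia).
    (* Three copies of [d] are exchanged for [d] copies of [a = 3]. *)
    exists (N + J / 3 * d), (J mod 3), 0. split; [|split; [lia|]].
    + destruct (Z.eq_dec N 0) as [E0 | ]; [|nia].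
      assert (J = 0) as -> by nia. rewrite E0. simpl. lia.
    + rewrite H at 1. ring.
  - intros (n' & j' & y' & Hj' & Hy' & ->).
    exists (n' + y'), j', 0. split; [nia | lia].
Qed.

(** Pairing [c + d] shows that [c] is redundant, which is (a), or [c + d = n a]. In the latter case
    pairing [c - a] gives redundancy again or [2 d + a = (y1 + 1) c]. *)
Lemma frobenius_2d_case (a d c k : Z) :
  0 < a -> 0 < d -> 0 < c -> 2 <= k -> gcd_list (gens a d c k) = 1 -> Z.gcd a d = 1 ->
  PSym (SG a d c k) d ->
  (forall x, SG a d c k x <-> SG 3 d 3 2 x) \/ (a * (c - 1) = 2 * (c + d) /\ Z.Odd c).
Proof.
  intros Ha Hd Hc Hk Hgl Hg HP.
  pose proof (PSym_a_gt_1 _ _ _ _ _ Ha Hd Hc Hk HP) as Ha1.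
  pose proof (PSym_d_gap _ _ _ _ _ Ha Hd Hc Hk Hgl HP) as Nd.
  destruct HP as (N2d & Hx & Hz).
  assert (H3d : SG a d c k (3 * d)) by (apply Hx; lia).
  assert (Red : forall n j, 0 <= j <= k * n -> c = n * a + j * d ->
     forall x, SG a d c k x <-> SG 3 d 3 2 x).
  { intros n j. apply redundant_c_case; assumption. }
  assert (Hcd : SG a d c k (c + d)).
  { destruct (proj2 (Hz (c + d)) ltac:(lia)) as [H | H]; [exact H|].
    destruct Nd. pose proof (SG_add _ _ _ _ _ _ H (SG_c a d c k)) as H'.
    replace (2 * d - (c + d) + c) with d in H' by lia. exact H'. }
  destruct Hcd as (n & j & y & Hj & Hy & Ecd). assert (Hn : 0 <= n) by nia.
  assert (y = 0).
  { destruct (Z.eq_dec y 0) as [|]; [assumption|]. destruct Nd. exists n, j, (y - 1). lia. }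
  subst y. destruct (Z.eq_dec j 0) as [-> | Nj]; [|left; apply (Red n (j - 1)); lia].
  destruct (classic (SG a d c k (c - a))) as [H | Nca].
  { left. destruct H as (n1 & j1 & y1 & Hj1 & Hy1 & E1). assert (0 <= n1) by nia.
    assert (y1 = 0) by nia. apply (Red (n1 + 1) j1); nia. }
  destruct (Z.eq_dec (c - a) d) as [Ed | Ned]; [left; apply (Red 1 1); lia|].
  right. destruct (proj2 (Hz (c - a)) Ned) as [H | H]; [contradiction|].
  destruct H as (n1 & j1 & y1 & Hj1 & Hy1 & E1). assert (Hn1 : 0 <= n1) by nia.
  assert (n1 = 0).
  { destruct (Z.eq_dec n1 0) as [|Nn]; [assumption|exfalso].
    destruct (Z.eq_dec j1 0) as [-> | Nj1].
    - apply N2d. exists (n1 - 1), 0, (y1 + 1). nia.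
    - destruct (Z.eq_dec j1 1) as [-> | Nj2].
      + apply Nd. exists (n1 - 1), 0, (y1 + 1). nia.
      + nia. }
  assert (j1 = 0) by nia. subst n1 j1.
  assert (Hya : y1 + 1 < a).
  { apply Z.nle_gt. intros Hle. apply N2d.
    exists (c - 1), 0, (y1 + 1 - a). nia. }
  (* Modulo [a], [c] is [- d], so [2 d = (y1 + 1) c] becomes [(y1 + 3) d = 0]. *)
  assert (Hdiv : (a | y1 + 3)).
  { apply (Z.gauss _ d); [exists ((y1 + 1) * n - 1)|exact Hg].
    assert (Hc' : c = n * a - d) by lia. rewrite Hc' in E1. lia. }
  assert (Ey : y1 + 3 = a).
  { destruct Hdiv as [r Hr]. assert (r = 1) by nia. nia. }
  assert (Eb : a * (c - 1) = 2 * (c + d)) by nia.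
  split; [exact Eb|].
  (* An even [c] would make [a] and [d] both even. *)
  destruct (Z.Even_or_Odd c) as [[c' Ec] | HO]; [exfalso | exact HO].
  assert (Ea : (2 | a)).
  { apply (Z.gauss _ (c - 1)); [exists (c + d); lia|].
    subst c. replace (2 * c' - 1) with (-1 + c' * 2) by ring.
    rewrite Z.gcd_add_mult_diag_r. reflexivity. }
  assert (Ed : (2 | d)).
  { destruct Ea as [a' ->]. exists (n * a' - c'). lia. }
  pose proof (Z.gcd_greatest _ _ _ Ea Ed) as G. rewrite Hg in G.
  apply Z.divide_1_r in G. lia.
Qed.

(** * The Frobenius number at one corner and its half at the other *)

Lemma le_of_mul_lt (k x y : Z) : 0 < k -> k * y - k < k * x -> y <= x.
Proof. nia. Qed.

(** There are two ways to repair the coefficient [- p]: trade [s] copies of [d] by the first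
    relation, or use the second one backwards at the cost [- (t + k * E)]. *)
Lemma corner_difference_12 (a d c k s t p q D E m i : Z) :
  herzog_basis a d c k s t p q D E -> 0 < p ->
  SG a d c k (m * a + (t + i) * d + (- p) * c) ->
  s - t <= i \/ - (t + k * E) <= k * m - (t + i).
Proof.
  intros HB Hp0 HS.
  destruct (hb_compare _ _ _ _ _ _ _ _ _ _ _ _ _ HB HS) as (x & z & H1 & H2 & H3).
  destruct HB as [Hs Hp _ _ _ HR HT _].
  set (R := s + k * D) in *. set (T := t + k * E) in *.
  destruct (Z_lt_le_dec 0 z) as [Hz | Hz].
  - destruct (Z_lt_le_dec x 0) as [Hx | Hx]; [left; nia|].
    right. assert (0 <= x * R) by nia. nia.
  - left. assert (x + 1 <= z) by nia. nia.
Qed.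

(** Either [i - t] is already nonnegative, or the first relation is used backwards at the cost
    [s + k * D]. *)
Lemma corner_difference_21 (a d c k s t p q D E m i : Z) :
  herzog_basis a d c k s t p q D E ->
  SG a d c k (m * a + (i - t) * d + p * c) ->
  t <= i \/ s + k * D <= k * m - (i - t).
Proof.
  intros HB HS.
  destruct (hb_compare _ _ _ _ _ _ _ _ _ _ _ _ _ HB HS) as (x & z & H1 & H2 & H3).
  destruct HB as [Hs Hp _ _ _ HR HT _].
  set (R := s + k * D) in *. set (T := t + k * E) in *.
  destruct (Z_lt_le_dec 0 x) as [Hx | Hx].
  - right. assert (0 <= z) by nia. assert (z * T <= 0) by nia. nia.
  - left. destruct (Z_lt_le_dec z 0) as [Hz | Hz]; [|nia].
    assert (x <= z) by nia. nia.
Qed.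

Lemma frobenius_corner_1 (a d c k s t p q D E m1 m2 r2 h j : Z) :
  2 <= k -> herzog_basis a d c k s t p q D E -> corner_data k s t m1 0 m2 r2 ->
  0 < p -> 0 < t -> 0 <= j <= r2 ->
  2 * h = corner a d c m1 (s - 1) (q - p - 1) 0 ->
  h = corner a d c m2 (s - t - 1) (q - 1) j -> ~ SG a d c k h ->
  (forall i, 0 <= i <= r2 -> i <> j ->
     SG a d c k (2 * h - corner a d c m2 (s - t - 1) (q - 1) i)) ->
  p = 1 /\ ((s = t + 1 /\ t + k * E = 1 - 2 * k) \/ (s = t + 3 /\ t + k * E = - 1)).
Proof.
  intros Hk HB [H1 _ H2 Hr2] Hp0 Ht0 Hj Eg Eh Nh HX.
  unfold corner in *.
  (* Every paired term satisfies one of two inequalities; the term [h], whose mirror image is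
     itself, violates both ([HJ1], [HJ2]). *)
  assert (HI : forall i, 0 <= i <= r2 -> i <> j -> s - t <= i \/ - (t + k * E) <= r2 - i).
  { intros i Hi Ni. specialize (HX i Hi Ni).
    replace (r2 - i) with (k * (m1 - m2) - (t + i)) by lia.
    apply (corner_difference_12 _ _ _ _ _ _ _ _ _ _ _ _ HB Hp0).
    apply (SG_eq _ _ _ _ _ _ HX). lia. }
  pose proof HB as [Hs Hp Hdet HD HE HR HT Hg].
  assert (Eh' : h = (m1 - m2) * a + (t + j) * d + (- p) * c) by lia.
  assert (HJ1 : j < s - t).
  { apply Z.nle_gt. intros Hle. apply Nh. rewrite Eh'.
    exists (m1 - m2 + D), (t + j - s), 0. lia. }
  assert (HJ2 : r2 - j < - (t + k * E)).
  { apply Z.nle_gt. intros Hle. apply Nh. rewrite Eh'.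
    exists (m1 - m2 + E), j, (q - p). lia. }
  (* This is [2 h = g] as a relation. In each surviving case it is the second basic relation itself,
     [x = 0] and [y = 1]. *)
  destruct (hb_lattice _ _ _ _ _ _ _ _ _ _ (2 * m2 - m1) (s - 1 - 2 * t - 2 * j) (q + p - 1) HB)
    as (x & y & Eu & Ew & En); [lia|].
  assert (Eh3 : x * (s + k * D) - y * (t + k * E) = (s - 1 - 2 * t - 2 * j) - k * (2 * m2 - m1)).
  { rewrite Eu, En. ring. }
  clear HX Nh Eh Eh' Eg HD HE Hg Hdet En.
  set (tau := - (m1 - m2 + E)).
  assert (ET : - (t + k * E) = r2 + k * tau) by (unfold tau; lia).
  assert (Htau : 0 <= tau) by (apply (le_of_mul_lt k); lia).
  set (R := s + k * D) in *. set (T := - (t + k * E)) in *.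
  assert (ERT : x * R + y * T = (s - 1 - 2 * t - 2 * j) - k * (2 * m2 - m1)) by (unfold T; lia).
  clear Eh3. clearbody R tau.
  assert (Hm2 : -1 <= m2) by (apply (le_of_mul_lt k); lia).
  destruct (Z.eq_dec m2 (-1)) as [Em | Nm].
  - (* corner 2 lies in the first column, giving (e) *)
    assert (r2 = k - 1 /\ s = t + 1 /\ j = 0) as (Er & Es & Ej) by lia.
    subst m2 r2 s j.
    assert (1 <= tau) by (apply (le_of_mul_lt k); lia).
    assert (HT2 : 2 * k - 1 <= T) by (clear - H ET Hk; nia).
    assert (Eu' : (y - 1) * t = x * (t + 1)) by lia.
    assert (ERT' : x * R + y * T = 2 * k - 1) by lia.
    assert (x = 0).
    { destruct (Z.lt_trichotomy x 0) as [L | [L | L]]; [exfalso | exact L | exfalso].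
      - assert (y < 0) by (clear - L Ht0 Eu'; nia). clear - HR L H0 HT2 Hk ERT'; nia.
      - assert (2 <= y) by (clear - L Ht0 Eu'; nia). clear - HR L H0 HT2 Hk ERT'; nia. }
    subst x. assert (y = 1) by (clear - Ht0 Eu'; nia). subst y. split; [lia|]. left. split; [lia|].
    unfold T in *. lia.
  - assert (Hst : r2 + 2 <= s - t) by (clear - H2 Hm2 Nm Hk; nia).
    destruct (Z.eq_dec tau 0) as [E0 | N0].
    + (* [T = r2], giving (f) *)
      subst tau. assert (ET' : T = r2) by lia.
      assert (r2 = 1 /\ j = 1) as (Er & Ej).
      { assert (1 <= j) by lia.
        destruct (Z.eq_dec j 1) as [-> | ].
        - destruct (Z.eq_dec r2 1) as [|]; [lia|]. destruct (HI 2); lia.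
        - destruct (HI 1); lia. }
      assert (ET1 : T = 1) by lia. subst j. rewrite ET1 in ERT.
      assert (ERT' : x * R + y = 1) by lia.
      assert (x = 0).
      { destruct (Z.lt_trichotomy x 0) as [L | [L | L]]; [exfalso | exact L | exfalso].
        - assert (2 <= y) by (clear - HR L ERT'; nia). clear - H L Eu Ht0 Hs; nia.
        - assert (y <= 0) by (clear - HR L ERT'; nia). clear - H L Ew Hp0 Hp; nia. }
      subst x. assert (y = 1) by lia. subst y. split; [lia|]. right. unfold T in *. lia.
    + exfalso.
      (* Now both alternatives of [HI] fail throughout, so the progression has one term. *)
      assert (HT2 : r2 + k <= T) by (clear - Htau N0 ET Hk; nia).
      assert (r2 = 0 /\ j = 0) as (Er & Ej).
      { destruct (Z.eq_dec j 0) as [-> | ].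
        - destruct (Z.eq_dec r2 0) as [|]; [lia|]. destruct (HI 1); lia.
        - destruct (HI 0); lia. }
      subst r2 j.
      assert (ERT' : x * R + y * T = 1) by lia.
      assert (HT2' : 2 <= T) by lia. clearbody T.
      destruct (Z.lt_trichotomy x 0) as [L | [L | L]].
      * assert (1 <= y) by (clear - L HR ERT' HT2 Hk; nia).
        clear - H L Eu Hs Ht0; assert (y = 1 \/ 2 <= y) as [-> | ] by lia; nia.
      * subst x. clear - ERT' HT2'; assert (0 < y) by nia; nia.
      * assert (y <= 0).
        { clear - L HR ERT' HT2'; assert (0 < x * R) by nia; nia. }
        clear - H L Ew Hp0 Hp; nia.
Qed.

Lemma frobenius_corner_2 (a d c k s t p q D E m1 r1 m2 h j : Z) :
  2 <= k -> herzog_basis a d c k s t p q D E -> corner_data k s t m1 r1 m2 0 ->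
  0 < p -> 0 < t -> 0 <= j <= r1 ->
  2 * h = corner a d c m2 (s - t - 1) (q - 1) 0 ->
  h = corner a d c m1 (s - 1) (q - p - 1) j -> ~ SG a d c k h ->
  (forall i, 0 <= i <= r1 -> i <> j ->
     SG a d c k (2 * h - corner a d c m1 (s - 1) (q - p - 1) i)) ->
  q = p + 1 /\ ((t = 1 /\ s + k * D = 3) \/ (t = 2 * k - 1 /\ s + k * D = 1)).
Proof.
  intros Hk HB [H1 Hr1 H2 _] Hp0 Ht0 Hj Eg Eh Nh HX.
  unfold corner in *.
  assert (HI : forall i, 0 <= i <= r1 -> i <> j -> t <= i \/ s + k * D <= r1 - i).
  { intros i Hi Ni. specialize (HX i Hi Ni).
    replace (r1 - i) with (k * (m2 - m1) - (i - t)) by lia.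
    apply (corner_difference_21 _ _ _ _ _ _ _ _ _ _ _ _ HB).
    apply (SG_eq _ _ _ _ _ _ HX). lia. }
  pose proof HB as [Hs Hp Hdet HD HE HR HT Hg].
  assert (Eh' : h = (m2 - m1) * a + (j - t) * d + p * c) by lia.
  assert (HJ1 : j < t).
  { apply Z.nle_gt. intros Hle. apply Nh. rewrite Eh'. apply SG_intro; lia. }
  assert (HJ2 : r1 - j < s + k * D).
  { apply Z.nle_gt. intros Hle. apply Nh. rewrite Eh'.
    exists (m2 - m1 - D), (j - t + s), 0. lia. }
  (* Here the surviving cases give the first basic relation, [x = 1] and [y = 0]. *)
  destruct (hb_lattice _ _ _ _ _ _ _ _ _ _ (2 * m1 - m2) (s + t - 1 - 2 * j) (q - 1 - 2 * p) HB)
    as (x & y & Eu & Ew & En); [lia|].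
  assert (ERT : x * (s + k * D) - y * (t + k * E) = (s + t - 1 - 2 * j) - k * (2 * m1 - m2)).
  { rewrite Eu, En. ring. }
  clear HX Nh Eh Eh' Eg HD HE Hg Hdet En.
  assert (ER : s + k * D = r1 + 2 + k * (m1 + D)) by lia.
  assert (Et : t = r1 + k * (m1 - m2)) by lia.
  set (T := t + k * E) in *. set (R := s + k * D) in *.
  set (rho := m1 + D) in *. clearbody T R rho.
  assert (Hrho : -1 <= rho) by (apply (le_of_mul_lt k); lia).
  assert (Hm : 0 <= m1 - m2) by (apply (le_of_mul_lt k); lia).
  destruct (Z.eq_dec rho (-1)) as [Em | Nm].
  - (* [R = 1], giving (d) *)
    assert (r1 = k - 1 /\ R = 1) as (Er & ER1) by lia.
    assert (j = k - 1).
    { destruct (Z.eq_dec j (k - 1)) as [|]; [assumption|]. destruct (HI (k - 1)); lia. }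
    subst r1 j R.
    assert (1 <= m1 - m2) by (apply (le_of_mul_lt k); lia).
    assert (Ht2 : 2 * k - 1 <= t) by (clear - H Et Hk; nia).
    assert (ERT' : x - y * T = 1) by lia.
    assert (x = 1).
    { destruct (Z.lt_trichotomy x 1) as [L | [L | L]]; [exfalso | exact L | exfalso].
      - assert (1 <= y) by (clear - L HT ERT'; nia). clear - H0 L Eu Ht2 Hs Hk; nia.
      - assert (y < 0) by (clear - L HT ERT'; nia). clear - H0 L Eu Ht2 Hs Hk; nia. }
    subst x. assert (y = 0) by (clear - Eu Ht2 Hk ERT'; nia). subst y. lia.
  - assert (HR2 : r1 + 2 <= R) by (clear - ER Hrho Nm Hk; nia).
    destruct (Z.eq_dec (m1 - m2) 0) as [E0 | N0].
    + (* [t = r1], giving (c) *)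
      rewrite E0 in Et.
      assert (r1 = 1 /\ j = 0) as (Er & Ej).
      { destruct (Z.eq_dec j 0) as [-> | ].
        - destruct (Z.eq_dec r1 1) as [|]; [lia|]. destruct (HI 1); lia.
        - destruct (HI 0); lia. }
      subst r1 j. assert (t = 1) by lia. subst t.
      assert (ERT' : x * R - y * T = 3) by lia.
      assert (Ey : y = (x - 1) * s) by lia.
      assert (x = 1).
      { destruct (Z.lt_trichotomy x 1) as [L | [L | L]]; [exfalso | exact L | exfalso].
        - assert (Hy : y < 0) by (clear - L Ey Hs; nia).
          clear - Hy L HR2 HT ERT'; assert (x * R <= 0) by nia; nia.
        - assert (Hy : 2 * (x - 1) <= y).
          { assert (0 <= (x - 1) * (s - 2)) by (apply Z.mul_nonneg_nonneg; lia). lia. }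
          clear - Hy L Ew Hp.
          assert (2 * (x - 1) * q <= y * q) by (apply Z.mul_le_mono_nonneg_r; lia). assert ((x - 2) * p <= (x - 2) * q) by (apply Z.mul_le_mono_nonneg_l; lia).
          assert (0 <= (x - 1) * q) by (apply Z.mul_nonneg_nonneg; lia). lia. }
      subst x. lia.
    + exfalso. assert (Ht2 : r1 + k <= t) by (clear - Et Hm N0 Hk; nia).
      assert (r1 = 0 /\ j = 0) as (Er & Ej).
      { destruct (Z.eq_dec j 0) as [-> | ].
        - destruct (Z.eq_dec r1 0) as [|]; [lia|]. destruct (HI 1); lia.
        - destruct (HI 0); lia. }
      subst r1 j.
      assert (ERT' : x * R - y * T = 1) by lia.
      destruct (Z.lt_trichotomy x 1) as [L | [L | L]].
      * assert (1 <= y) by (clear - L HR2 HT ERT'; nia). clear - H L Eu Ht2 Hs Hk; nia.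
      * subst x. assert (Eu' : (y + 1) * t = 1) by lia. clear - Eu' Ht2 Hk.
        assert (0 < y + 1) by nia. nia.
      * assert (y < 0) by (clear - L HR2 HT ERT'; nia). clear - H L Eu Ht2 Hs Hk; nia.
Qed.

Lemma PSym_cases (a d c k s t p q D E h : Z) :
  0 < a -> 0 < d -> 0 < c -> 2 <= k -> gcd_list (gens a d c k) = 1 ->
  herzog_basis a d c k s t p q D E -> PSym (SG a d c k) h ->
  (forall x, SG a d c k x <-> SG 3 d 3 2 x) \/
  (a * (c - 1) = 2 * (c + d) /\ Z.Odd c) \/
  (q = p + 1 /\ ((t = 1 /\ s + k * D = 3) \/ (t = 2 * k - 1 /\ s + k * D = 1))) \/
  (p = 1 /\ (exists m, s - 2 = k * m) /\
    ((s = t + 1 /\ t + k * E = 1 - 2 * k) \/ (s = t + 3 /\ t + k * E = - 1))).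
Proof.
  intros Ha Hd Hc Hk Hgl HB HP. assert (Hk0 : 0 < k) by lia.
  destruct (classic (SG a d c k (2 * h - d))) as [Hgd | Ngd].
  2:{ pose proof (PSym_d_gap _ _ _ _ _ Ha Hd Hc Hk Hgl HP) as Nd.
      assert (h = d).
      { destruct (Z.eq_dec (2 * h - d) h) as [|Ne]; [lia|].
        destruct (proj2 (proj2 (proj2 HP) _) Ne) as [H | H]; [contradiction|].
        replace (2 * h - (2 * h - d)) with d in H by lia. contradiction. }
      subst h.
      destruct (frobenius_2d_case a d c k Ha Hd Hc Hk Hgl (hb_coprime _ _ _ _ _ _ _ _ _ _ HB) HP);
        [left | right; left]; assumption. }
  destruct (corner_data_exist k s t ltac:(lia)) as (m1 & r1 & m2 & r2 & HC).
  set (X1 := fun x => exists j, 0 <= j <= r1 /\ x = corner a d c m1 (s - 1) (q - p - 1) j).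
  set (X2 := fun x => exists j, 0 <= j <= r2 /\ x = corner a d c m2 (s - t - 1) (q - 1) j).
  assert (G1 : forall x, X1 x -> ~ SG a d c k x).
  { intros x (j & Hj & ->). exact (corner1_gap _ _ _ _ _ _ _ _ _ _ _ _ _ _ _ HB HC Hj). }
  assert (G2 : forall x, X2 x -> ~ SG a d c k x).
  { intros x (j & Hj & ->). exact (corner2_gap _ _ _ _ _ _ _ _ _ _ _ _ _ _ _ HB HC Hj). }
  assert (Spos : forall x, SG a d c k x -> 0 <= x) by (intros x; apply SG_nonneg; lia).
  destruct (PSym_generators (SG a d c k) (fun x => X1 x \/ (0 < p /\ X2 x)) h) as [Xg Xh].
  { apply SG_add. }
  { exact Spos. }
  { intros z Hz. destruct (gap_below_corner _ _ _ _ _ _ _ _ _ _ _ _ _ _ _ Hk0 HB HC Hz)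
      as [[(j & Hj & HS) | (Hp & j & Hj & HS)] _]; eexists; (split; [|exact HS]);
      [left | right; split; [exact Hp|]]; exists j; auto. }
  { intros x [H | [_ H]]; auto. }
  { exact HP. }
  destruct (PSym_generators (SG a d c k) (fun x => (0 < t /\ X1 x) \/ X2 x) h) as [Yg Yh].
  { apply SG_add. }
  { exact Spos. }
  { intros z Hz. destruct (gap_below_corner _ _ _ _ _ _ _ _ _ _ _ _ _ _ _ Hk0 HB HC Hz)
      as [_ [(Ht & j & Hj & HS) | (j & Hj & HS)]]; eexists; (split; [|exact HS]);
      [left; split; [exact Ht|] | right]; exists j; auto. }
  { intros x [[_ H] | H]; auto. }
  { exact HP. }
  destruct HP as (Ng & Hx & Hz).
  assert (Nh : ~ SG a d c k h) by (intros H; apply (proj1 (Hz h)); auto).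
  assert (h0 : h <> 0) by (intros ->; apply Nh, SG_0).
  (* The first term of a progression is its largest, so it is [2 h]; a second term would be
     [2 h - d], which is no gap. *)
  assert (A1 : X1 (2 * h) -> 2 * h = corner a d c m1 (s - 1) (q - p - 1) 0 /\ r1 = 0).
  { intros (j & Hj & Ej). assert (j = 0).
    { destruct (Z.eq_dec j 0) as [|Nj]; [assumption|exfalso].
      apply (G1 (corner a d c m1 (s - 1) (q - p - 1) 0)); [exists 0; split; [lia | reflexivity]|].
      apply Hx. unfold corner in *. assert (0 < j * d) by (apply Z.mul_pos_pos; lia). lia. }
    subst j. split; [exact Ej|]. destruct (Z.eq_dec r1 0) as [|Nr]; [assumption|exfalso].
    apply (G1 (2 * h - d)); [|exact Hgd]. exists 1. unfold corner in *. lia. }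
  assert (A2 : X2 (2 * h) -> 2 * h = corner a d c m2 (s - t - 1) (q - 1) 0 /\ r2 = 0).
  { intros (j & Hj & Ej). assert (j = 0).
    { destruct (Z.eq_dec j 0) as [|Nj]; [assumption|exfalso].
      apply (G2 (corner a d c m2 (s - t - 1) (q - 1) 0)); [exists 0; split; [lia | reflexivity]|].
      apply Hx. unfold corner in *. assert (0 < j * d) by (apply Z.mul_pos_pos; lia). lia. }
    subst j. split; [exact Ej|]. destruct (Z.eq_dec r2 0) as [|Nr]; [assumption|exfalso].
    apply (G2 (2 * h - d)); [|exact Hgd]. exists 1. unfold corner in *. lia. }
  assert (B1 : X1 (2 * h) -> ~ X1 h).
  { intros H (j & Hj & Ej). destruct (A1 H) as [E0 Er]. replace j with 0 in Ej by lia. lia. }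
  assert (B2 : X2 (2 * h) -> ~ X2 h).
  { intros H (j & Hj & Ej). destruct (A2 H) as [E0 Er]. replace j with 0 in Ej by lia. lia. }
  right; right.
  destruct Xg as [X1g | [Hp X2g]].
  - right. destruct Xh as [X1h | [Hp X2h]]; [destruct (B1 X1g X1h)|].
    destruct Yg as [[Ht _] | X2g]; [|destruct (B2 X2g X2h)].
    destruct (A1 X1g) as [Eg Er]. subst r1. destruct X2h as (j & Hj & Ej).
    destruct (frobenius_corner_1 _ _ _ _ _ _ _ _ _ _ _ _ _ _ _ Hk HB HC Hp Ht Hj Eg Ej Nh)
      as [Ep Ecase].
    { intros i Hi Ni. destruct (proj2 (Hz (corner a d c m2 (s - t - 1) (q - 1) i))) as [H | H].
      - rewrite Ej. unfold corner. intros E0. apply Ni. apply (Z.mul_reg_r _ _ d); lia.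
      - destruct (G2 _ (ex_intro _ i (conj Hi eq_refl)) H).
      - exact H. }
    split; [exact Ep|]. split; [exists m1; destruct HC; lia | exact Ecase].
  - left. destruct Yh as [[Ht X1h] | X2h]; [|destruct (B2 X2g X2h)].
    destruct (A2 X2g) as [Eg Er]. subst r2. destruct X1h as (j & Hj & Ej).
    apply (frobenius_corner_2 _ _ _ _ _ _ _ _ _ _ _ _ _ _ _ Hk HB HC Hp Ht Hj Eg Ej Nh).
    intros i Hi Ni. destruct (proj2 (Hz (corner a d c m1 (s - 1) (q - p - 1) i))) as [H | H].
    + rewrite Ej. unfold corner. intros E0. apply Ni. apply (Z.mul_reg_r _ _ d); lia.
    + destruct (G1 _ (ex_intro _ i (conj Hi eq_refl)) H).
    + exact H.
Qed.

(** * Sufficiency of the six conditions *)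

Lemma PSym_of_corners (a d c k s t p q D E m1 r1 m2 r2 h : Z) :
  0 < d -> 0 < c -> 2 <= k ->
  herzog_basis a d c k s t p q D E -> corner_data k s t m1 r1 m2 r2 ->
  ~ SG a d c k (2 * h) -> ~ SG a d c k h -> 0 < h ->
  (forall j, 0 <= j <= r1 ->
     SG a d c k (2 * h - corner a d c m1 (s - 1) (q - p - 1) j) \/
     corner a d c m1 (s - 1) (q - p - 1) j = h) ->
  (forall j, 0 <= j <= r2 ->
     SG a d c k (2 * h - corner a d c m2 (s - t - 1) (q - 1) j) \/
     corner a d c m2 (s - t - 1) (q - 1) j = h) ->
  PSym (SG a d c k) h.
Proof.
  intros Hd Hc Hk HB HC Ng Nh Hh H1 H2. assert (Hk0 : 0 < k) by lia.
  pose proof (hb_a_pos _ _ _ _ _ _ _ _ _ _ HB) as Ha.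
  apply (PSym_of_generators _ (fun x =>
    (exists j, 0 <= j <= r1 /\ x = corner a d c m1 (s - 1) (q - p - 1) j) \/
    (exists j, 0 <= j <= r2 /\ x = corner a d c m2 (s - t - 1) (q - 1) j))); try assumption.
  - apply SG_add.
  - intros x. apply SG_nonneg; lia.
  - intros z Hz. destruct (gap_below_corner _ _ _ _ _ _ _ _ _ _ _ _ _ _ _ Hk0 HB HC Hz)
      as [[(j & Hj & HS) | (_ & j & Hj & HS)] _]; eexists; (split; [|exact HS]);
      [left | right]; exists j; auto.
  - intros x [(j & Hj & ->) | (j & Hj & ->)]; auto.
Qed.

(** [h] is the first of the two terms at corner 1, and the first relation identifies [2 h] with the
    only term at corner 2. *)
Lemma PSym_case_c (a d c k s t p q D E : Z) :
  0 < d -> 0 < c -> 2 <= k -> herzog_basis a d c k s t p q D E ->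
  t = 1 -> q = p + 1 -> s + k * D = 3 -> exists h, PSym (SG a d c k) h.
Proof.
  intros Hd Hc Hk HB -> -> HR.
  assert (HC : corner_data k s 1 (- D) 1 (- D) 0) by (split; lia).
  pose proof (hb_a_pos _ _ _ _ _ _ _ _ _ _ HB) as Ha.
  pose proof (hb_D _ _ _ _ _ _ _ _ _ _ HB) as HD.
  pose proof (hb_s _ _ _ _ _ _ _ _ _ _ HB) as Hs.
  pose proof (hb_p _ _ _ _ _ _ _ _ _ _ HB) as Hp.
  assert (HD0 : 0 <= - D) by (apply (le_of_mul_lt k); lia).
  pose proof (corner1_gap _ _ _ _ _ _ _ _ _ _ _ _ _ _ 0 HB HC ltac:(lia)) as N1.
  pose proof (corner2_gap _ _ _ _ _ _ _ _ _ _ _ _ _ _ 0 HB HC ltac:(lia)) as N2.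
  exists (- D * a + (s - 1) * d). unfold corner in *.
  apply (PSym_of_corners _ _ _ _ _ _ _ _ _ _ _ _ _ _ _ Hd Hc Hk HB HC); unfold corner.
  - intros H. apply N2, (SG_eq _ _ _ _ _ _ H). lia.
  - intros H. apply N1, (SG_eq _ _ _ _ _ _ H). lia.
  - nia.
  - intros j Hj. assert (j = 0 \/ j = 1) as [-> | ->] by lia; [right; lia | left].
    exists 0, 0, p. lia.
  - intros j Hj. left. exists 0, 0, 0. nia.
Qed.

(** [h] is the last term at corner 1, with [j = k - 1]. *)
Lemma PSym_case_d (a d c k s t p q D E : Z) :
  0 < d -> 0 < c -> 2 <= k -> herzog_basis a d c k s t p q D E ->
  t = 2 * k - 1 -> q = p + 1 -> s + k * D = 1 -> exists h, PSym (SG a d c k) h.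
Proof.
  intros Hd Hc Hk HB -> -> HR.
  assert (HC : corner_data k s (2 * k - 1) (- D - 1) (k - 1) (- D - 2) 0) by (split; lia).
  pose proof (hb_a_pos _ _ _ _ _ _ _ _ _ _ HB) as Ha.
  pose proof (hb_D _ _ _ _ _ _ _ _ _ _ HB) as HD.
  pose proof (hb_s _ _ _ _ _ _ _ _ _ _ HB) as Hs.
  assert (HD0 : 0 <= - D - 1) by (apply (le_of_mul_lt k); lia).
  pose proof (corner1_gap _ _ _ _ _ _ _ _ _ _ _ _ _ _ (k - 1) HB HC ltac:(lia)) as N1.
  pose proof (corner2_gap _ _ _ _ _ _ _ _ _ _ _ _ _ _ 0 HB HC ltac:(lia)) as N2.
  exists ((- D - 1) * a + (s - k) * d). unfold corner in *.
  apply (PSym_of_corners _ _ _ _ _ _ _ _ _ _ _ _ _ _ _ Hd Hc Hk HB HC); unfold corner.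
  - intros H. apply N2, (SG_eq _ _ _ _ _ _ H). lia.
  - intros H. apply N1, (SG_eq _ _ _ _ _ _ H). lia.
  - nia.
  - intros j Hj. destruct (Z.eq_dec j (k - 1)) as [-> | ]; [right; lia | left].
    exists (- D - 1), (s - 2 * k + 1 + j), 0. lia.
  - intros j Hj. assert (j = 0) as -> by lia. left. exists 0, 0, 0. lia.
Qed.

(** [h] is the first term at corner 2, and [2 h] is the only term at corner 1. *)
Lemma PSym_case_e (a d c k s t p q D E m : Z) :
  0 < d -> 0 < c -> 2 <= k -> herzog_basis a d c k s t p q D E ->
  p = 1 -> s - 2 = k * m -> s = t + 1 -> t + k * E = 1 - 2 * k ->
  exists h, PSym (SG a d c k) h.
Proof.
  intros Hd Hc Hk HB -> Hm Es HT.
  assert (HC : corner_data k s t m 0 (- 1) (k - 1)) by (split; lia).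
  pose proof (hb_a_pos _ _ _ _ _ _ _ _ _ _ HB) as Ha.
  pose proof (hb_s _ _ _ _ _ _ _ _ _ _ HB) as Hs.
  pose proof (hb_p _ _ _ _ _ _ _ _ _ _ HB) as Hp.
  pose proof (hb_D _ _ _ _ _ _ _ _ _ _ HB) as HD.
  pose proof (hb_E _ _ _ _ _ _ _ _ _ _ HB) as HE.
  pose proof (hb_R _ _ _ _ _ _ _ _ _ _ HB) as HR.
  assert (Hm0 : 0 <= m) by (apply (le_of_mul_lt k); lia).
  assert (EE : E = - m - 2) by (apply (Z.mul_reg_l _ _ k); lia).
  pose proof (corner1_gap _ _ _ _ _ _ _ _ _ _ _ _ _ _ 0 HB HC ltac:(lia)) as N1.
  pose proof (corner2_gap _ _ _ _ _ _ _ _ _ _ _ _ _ _ 0 HB HC ltac:(lia)) as N2.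
  exists (- a + (q - 1) * c). unfold corner in *. subst s E.
  apply (PSym_of_corners _ _ _ _ _ _ _ _ _ _ _ _ _ _ _ Hd Hc Hk HB HC); unfold corner.
  - intros H. apply N1, (SG_eq _ _ _ _ _ _ H). lia.
  - intros H. apply N2, (SG_eq _ _ _ _ _ _ H). lia.
  - assert (0 < t) by nia. assert (0 < m * a + t * d + (q - 2) * c) by nia. lia.
  - intros j Hj. assert (j = 0) as -> by lia. left. exists 0, 0, 0. lia.
  - intros j Hj. destruct (Z.eq_dec j 0) as [-> | ]; [right; lia | left].
    (* The difference of the two relations reads [d + (q - 1) c = (D - E) a] with
       [D - E = m + 2 + D]. *)
    exists (m + 1 + D), (j - 1), 0. lia.
Qed.

(** [h] is the second term at corner 2. *)
Lemma PSym_case_f (a d c k s t p q D E m : Z) :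
  0 < d -> 0 < c -> 2 <= k -> herzog_basis a d c k s t p q D E ->
  p = 1 -> s - 2 = k * m -> s = t + 3 -> t + k * E = - 1 ->
  exists h, PSym (SG a d c k) h.
Proof.
  intros Hd Hc Hk HB -> Hm Es HT.
  assert (HC : corner_data k s t m 0 0 1) by (split; lia).
  pose proof (hb_p _ _ _ _ _ _ _ _ _ _ HB) as Hp.
  pose proof (hb_E _ _ _ _ _ _ _ _ _ _ HB) as HE.
  assert (EE : E = - m) by (apply (Z.mul_reg_l _ _ k); lia).
  pose proof (corner1_gap _ _ _ _ _ _ _ _ _ _ _ _ _ _ 0 HB HC ltac:(lia)) as N1.
  pose proof (corner2_gap _ _ _ _ _ _ _ _ _ _ _ _ _ _ 1 HB HC ltac:(lia)) as N2.
  exists (d + (q - 1) * c). unfold corner in *. subst s E.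
  apply (PSym_of_corners _ _ _ _ _ _ _ _ _ _ _ _ _ _ _ Hd Hc Hk HB HC); unfold corner.
  - intros H. apply N1, (SG_eq _ _ _ _ _ _ H). lia.
  - intros H. apply N2, (SG_eq _ _ _ _ _ _ H). lia.
  - nia.
  - intros j Hj. assert (j = 0) as -> by lia. left. exists 0, 0, 0. lia.
  - intros j Hj. assert (j = 0 \/ j = 1) as [-> | ->] by lia; [left | right; lia].
    exists 0, 0, (q - 1). lia.
Qed.

(** The generator [c = 3] repeats [a]. With [t = p = 0] both corners coincide, and their terms are
    [2 d] and [d]. *)
Lemma PSym_case_a (d : Z) : 0 < d -> Z.gcd 3 d = 1 -> PSym (SG 3 d 3 2) d.
Proof.
  intros Hd Hg.
  assert (HB : herzog_basis 3 d 3 2 3 0 0 1 d (- 1)) by (split; try lia; exact Hg).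
  assert (HC : corner_data 2 3 0 0 1 0 1) by (split; lia).
  pose proof (corner1_gap _ _ _ _ _ _ _ _ _ _ _ _ _ _ 0 HB HC ltac:(lia)) as N1.
  pose proof (corner1_gap _ _ _ _ _ _ _ _ _ _ _ _ _ _ 1 HB HC ltac:(lia)) as N2.
  unfold corner in *.
  apply (PSym_of_corners 3 d 3 2 _ _ _ _ _ _ _ _ _ _ _ Hd ltac:(lia) ltac:(lia) HB HC);
    unfold corner.
  - intros H. apply N1, (SG_eq _ _ _ _ _ _ H). lia.
  - intros H. apply N2, (SG_eq _ _ _ _ _ _ H). lia.
  - exact Hd.
  - intros j Hj. assert (j = 0 \/ j = 1) as [-> | ->] by lia; [left | right; lia].
    exists 0, 0, 0. lia.
  - intros j Hj. assert (j = 0 \/ j = 1) as [-> | ->] by lia; [left | right; lia].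
    exists 0, 0, 0. lia.
Qed.

(* The basis used here need not be the one with index [v]. *)
Lemma PSym_case_b (a d c k : Z) :
  0 < a -> 0 < d -> 0 < c -> 2 <= k -> Z.gcd a d = 1 ->
  a * (c - 1) = 2 * (c + d) -> Z.Odd c -> PSym (SG a d c k) d.
Proof.
  intros Ha Hd Hc Hk Hg Eb [n En].
  assert (Ecd : a * n = c + d) by nia.
  assert (Hn : 1 <= n) by nia.
  assert (Ha3 : 3 <= a) by nia.
  (* With [c = 2 n + 1], the relations are [3 d = (a - 3) c + (n - 1) a] and
     [(a - 2) c = 2 d + a]. *)
  assert (HB : herzog_basis a d c k 3 2 (a - 3) (a - 2) (n - 1) (- 1)).
  { split; try lia; try nia; exact Hg. }
  assert (HC : corner_data k 3 2 0 1 (- 1) (k - 1)) by (split; lia).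
  pose proof (corner1_gap _ _ _ _ _ _ _ _ _ _ _ _ _ _ 0 HB HC ltac:(lia)) as N1.
  pose proof (corner1_gap _ _ _ _ _ _ _ _ _ _ _ _ _ _ 1 HB HC ltac:(lia)) as N2.
  unfold corner in *.
  apply (PSym_of_corners _ _ _ _ _ _ _ _ _ _ _ _ _ _ _ Hd Hc Hk HB HC); unfold corner.
  - intros H. apply N1, (SG_eq _ _ _ _ _ _ H). lia.
  - intros H. apply N2, (SG_eq _ _ _ _ _ _ H). lia.
  - exact Hd.
  - intros j Hj. assert (j = 0 \/ j = 1) as [-> | ->] by lia; [left | right; lia].
    exists 0, 0, 0. lia.
  - intros j Hj. left. destruct (Z.eq_dec j 0) as [-> | ].
    + exists 0, 0, 1. lia.
    + exists n, (j - 1), 0. nia.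
Qed.

(** * The sequences [s], [P], [R] and the index [v] *)

Lemma s0_spec (a d c : Z) : 0 < a -> Z.gcd a d = 1 ->
  0 <= s0 a d c < a /\ (a | d * s0 a d c - c).
Proof.
  intros Ha Hg. unfold s0.
  destruct (find _ _) as [t|] eqn:Hf.
  - apply find_some in Hf as [Hin Ht]. apply in_map_iff in Hin as (i & <- & Hi).
    apply in_seq in Hi. split; [lia|].
    apply Z.mod_divide; [lia | apply Z.eqb_eq; exact Ht].
  - exfalso. destruct (Z.gcd_bezout a d 1 Hg) as (u & w & Huw).
    pose proof (Z.div_mod (w * c) a ltac:(lia)) as Hdm.
    pose proof (Z.mod_pos_bound (w * c) a ltac:(lia)) as Hb.
    assert (Hin : In ((w * c) mod a) (map Z.of_nat (seq 0 (Z.to_nat a)))).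
    { apply in_map_iff. exists (Z.to_nat ((w * c) mod a)). split; [lia | apply in_seq; lia]. }
    pose proof (find_none _ _ Hf _ Hin) as Hn. simpl in Hn. apply Z.eqb_neq in Hn.
    apply Hn. apply Z.mod_divide; [lia|].
    exists (- (u * c) - d * (w * c / a)).
    set (r := (w * c) mod a) in *. set (Q := w * c / a) in *.
    assert (Hr : r = w * c - a * Q) by lia.
    transitivity (d * (w * c - a * Q) - c * (u * a + w * d)); [|ring].
    rewrite Huw, <- Hr. ring.
Qed.

(** The last clause bounds the index by [P], so that [P_v = 1] leaves only [v = 0]. *)
Definition st_ok (a d c : Z) (n : nat) : Prop :=
  let '(x, y, p, q) := st a d c n in
  0 <= y < x /\ 0 <= p < q /\ x * q - y * p = a /\
  (a | d * x - c * p) /\ (a | d * y - c * q) /\ Z.of_nat n <= p.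

(* Past termination [st] is constantly [(0, 0, _, _)]. *)
Lemma st_is_ok (a d c : Z) (n : nat) : 0 < a -> Z.gcd a d = 1 ->
  st_ok a d c n \/ exists p q, st a d c n = (0, 0, p, q).
Proof.
  intros Ha Hg. induction n as [|n IH]; unfold st_ok in *; simpl.
  - left. destruct (s0_spec a d c Ha Hg) as [H1 H2].
    repeat split; try lia; [exists d; ring | rewrite Z.mul_1_r; exact H2].
  - destruct (st a d c n) as [[[x y] p] q] eqn:Est.
    destruct (Z.eqb_spec y 0) as [-> | Ny]; [right; do 2 eexists; reflexivity|].
    destruct IH as [(H1 & H2 & H3 & H4 & H5 & H6) | (p' & q' & Epq)]; [left|congruence].
    assert (Hy : 0 < y) by lia.
    pose proof (Z.div_mod (- x) y Ny) as Hdm. pose proof (Z.mod_pos_bound (- x) y Hy) as Hb.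
    set (r := (- x) mod y) in *. set (Q := (- x) / y) in *.
    assert (HQ : 2 <= - Q) by nia.
    split; [lia|]. split; [nia|]. split; [lia|]. split; [exact H5|]. split; [|lia].
    destruct H4 as [u4 H4], H5 as [u5 H5]. exists (- Q * u5 - u4).
    transitivity (- Q * (d * y - c * q) - (d * x - c * p)); [ring | rewrite H4, H5; ring].
Qed.

Lemma st_succ (a d c x y p q : Z) (n : nat) : st a d c n = (x, y, p, q) ->
  exists y' q', st a d c (S n) = (y, y', q, q').
Proof.
  intros H. simpl. rewrite H. destruct (Z.eqb_spec y 0) as [-> | ]; do 2 eexists; reflexivity.
Qed.

Lemma index_data (a d c k v : Z) :
  0 < a -> Z.gcd a d = 1 -> -1 <= v -> 0 < s_ a d c v ->
  0 <= s_ a d c (v + 1) < s_ a d c v /\ 0 <= P_ a d c v < P_ a d c (v + 1) /\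
  s_ a d c v * P_ a d c (v + 1) - s_ a d c (v + 1) * P_ a d c v = a /\
  v + 1 <= P_ a d c v /\
  exists D E, d * s_ a d c v - c * P_ a d c v = a * D /\
    d * s_ a d c (v + 1) - c * P_ a d c (v + 1) = a * E /\
    R_ a d c k v = s_ a d c v + k * D /\ R_ a d c k (v + 1) = s_ a d c (v + 1) + k * E.
Proof.
  intros Ha Hg Hv. unfold R_, s_, P_.
  replace (Z.to_nat (v + 1 + 1)) with (S (Z.to_nat (v + 1))) by lia.
  pose proof (st_is_ok a d c (Z.to_nat (v + 1)) Ha Hg) as Hok. unfold st_ok in Hok.
  destruct (st a d c (Z.to_nat (v + 1))) as [[[x y] p] q] eqn:Est.
  destruct (st_succ _ _ _ _ _ _ _ _ Est) as (y' & q' & ->).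
  intros Hx. destruct Hok as [Hok | (p' & q'' & Epq)]; [|injection Epq; lia].
  destruct Hok as (H1 & H2 & H3 & [D HD] & [E HE] & H6).
  split; [exact H1|]. split; [exact H2|]. split; [exact H3|]. split; [lia|].
  exists D, E. split; [lia|]. split; [lia|]. split.
  - replace ((a + k * d) * x - k * c * p) with (a * x + k * (d * x - c * p)) by ring.
    rewrite HD. replace (a * x + k * (D * a)) with ((x + k * D) * a) by ring.
    apply Z.div_mul; lia.
  - replace ((a + k * d) * y - k * c * q) with (a * y + k * (d * y - c * q)) by ring.
    rewrite HE. replace (a * y + k * (E * a)) with ((y + k * E) * a) by ring.
    apply Z.div_mul; lia.
Qed.

Lemma index_basis (a d c k v : Z) :
  0 < a -> Z.gcd a d = 1 -> -1 <= v -> 0 < s_ a d c v ->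
  R_ a d c k (v + 1) <= 0 < R_ a d c k v ->
  exists D E,
    herzog_basis a d c k (s_ a d c v) (s_ a d c (v + 1)) (P_ a d c v) (P_ a d c (v + 1)) D E /\
    R_ a d c k v = s_ a d c v + k * D /\ R_ a d c k (v + 1) = s_ a d c (v + 1) + k * E.
Proof.
  intros Ha Hg Hv Hs HR.
  destruct (index_data a d c k v Ha Hg Hv Hs) as (H1 & H2 & H3 & _ & D & E & HD & HE & ER & ET).
  exists D, E. split; [|split; assumption]. split; try assumption; lia.
Qed.

(** [R] starts at [a + k d > 0], [s] decreases strictly, and [R] is negative once [s] is [0]; so a
    sign change occurs on the way. *)
Lemma index_exists (a d c k : Z) : 0 < a -> 0 < d -> 0 < c -> 0 < k -> Z.gcd a d = 1 ->
  exists v, -1 <= v /\ 0 < s_ a d c v /\ R_ a d c k (v + 1) <= 0 < R_ a d c k v.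
Proof.
  intros Ha Hd Hc Hk Hg.
  assert (Hind : forall M, 0 <= M -> forall v, -1 <= v -> 0 < s_ a d c v ->
    s_ a d c (v + 1) <= M -> 0 < R_ a d c k v ->
    exists v, -1 <= v /\ 0 < s_ a d c v /\ R_ a d c k (v + 1) <= 0 < R_ a d c k v).
  { intros M HM. pattern M. apply Zlt_0_ind; [|exact HM]. clear M HM.
    intros M IH HM v Hv Hs Hle HR.
    destruct (index_data a d c k v Ha Hg Hv Hs) as (H1 & H2 & H3 & _ & D & E & HD & HE & ER & ET).
    destruct (Z_lt_le_dec 0 (R_ a d c k (v + 1))) as [HR1 | HR1]; [|exists v; lia].
    assert (Hs1 : 0 < s_ a d c (v + 1)).
    { destruct (Z.eq_dec (s_ a d c (v + 1)) 0) as [E0 | ]; [exfalso | lia].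
      rewrite E0 in *. assert (0 < c * P_ a d c (v + 1)) by (apply Z.mul_pos_pos; lia).
      assert (E < 0) by nia. nia. }
    destruct (index_data a d c k (v + 1) Ha Hg ltac:(lia) Hs1) as (H1' & _).
    apply (IH (M - 1)) with (v := v + 1); lia. }
  destruct (s0_spec a d c Ha Hg) as [Hs0 _].
  apply (Hind a) with (v := -1); unfold R_, s_, P_; simpl; try lia.
  - destruct (Z.eqb_spec (s0 a d c) 0); simpl; lia.
  - replace ((a + k * d) * a - k * c * 0) with ((a + k * d) * a) by ring.
    rewrite Z.div_mul by lia. nia.
Qed.

(** * From the sequences to the six conditions *)

Lemma mod_eq_intro (k x y m : Z) : 0 < k -> x = y + k * m -> x mod k = y mod k.
Proof. intros Hk ->. rewrite Z.mul_comm. apply Z.mod_add. lia. Qed.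

Lemma mod_eq_elim (k x y : Z) : 0 < k -> x mod k = y mod k -> exists m, x - y = k * m.
Proof.
  intros Hk H. exists (x / k - y / k).
  pose proof (Z.div_mod x k ltac:(lia)). pose proof (Z.div_mod y k ltac:(lia)). lia.
Qed.

(** Conditions (e) and (f) speak of [R_1] only; this gives [v = 0]. Since [D q = d + E], a
    nonpositive [s + k D = 2 + k (m + D)] would make [D q] smaller than [d - m - 2]. *)
Lemma first_R_pos (a d c k s t q D E m : Z) :
  0 < a -> 0 < d -> 2 <= k -> 0 < s -> 1 < q -> s * q - t * 1 = a ->
  d * s - c * 1 = a * D -> d * t - c * q = a * E ->
  s - 2 = k * m -> - m - 2 <= E -> 0 < s + k * D.
Proof.
  intros Ha Hd Hk Hs Hq Hdet HD HE Hm HmE.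
  assert (EDq : D * q = d + E).
  { apply (Z.mul_reg_l _ _ a); [lia|].
    transitivity ((d * s - c * 1) * q - (d * t - c * q) + a * E); [rewrite HD, HE; ring|].
    rewrite <- Hdet. ring. }
  assert (0 <= m) by (apply (le_of_mul_lt k); lia).
  apply Z.nle_gt. intros HR.
  assert (m + D <= -1) by nia. nia.
Qed.

Lemma P_0 (a d c : Z) : P_ a d c 0 = 1.
Proof. unfold P_. simpl. destruct (Z.eqb (s0 a d c) 0); reflexivity. Qed.

Lemma InSG_incl (G G' : list Z) (x : Z) : incl G G' -> InSG G x -> InSG G' x.
Proof. intros HG. induction 1; constructor; auto. Qed.

Lemma InSG_three (d x : Z) : InSG [3; 3 + d; 3 + 2 * d] x <-> SG 3 d 3 2 x.
Proof.
  rewrite <- InSG_gens by lia. split; apply InSG_incl; intros g.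
  - intros Hg. apply in_gens; [lia|]. left.
    destruct Hg as [<- | [<- | [<- | []]]]; [exists 0 | exists 1 | exists 2]; lia.
  - rewrite in_gens by lia. intros [(i & Hi & ->) | ->]; [|left; reflexivity].
    assert (i = 0 \/ i = 1 \/ i = 2) as [-> | [-> | ->]] by lia;
      [left | right; left | right; right; left]; ring.
Qed.

Lemma PSym_ext (S S' : Z -> Prop) (h : Z) :
  (forall x, S x <-> S' x) -> PSym S h -> PSym S' h.
Proof.
  intros H (H1 & H2 & H3). split; [rewrite <- H; exact H1|].
  split; [intros; apply H; auto|]. intros z. rewrite <- !H. apply H3.
Qed.

Theorem theorem7 (a d c k : Z) (ha : 0 < a) (hd : 0 < d) (hc : 0 < c) (hk : 2 <= k)
  (hgcd : gcd_list (gens a d c k) = 1) :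
  pseudo_symmetric (gens a d c k) <->
  (Z.gcd a d = 1 /\
   ( (* (a) *)
     (forall x, InSG (gens a d c k) x <-> InSG [3; 3 + d; 3 + 2 * d] x)
     (* (b) *)
   \/ (a * (c - 1) = 2 * (c + d) /\ Z.Odd c)
     (* (c), (d): v is the unique index -1 <= v <= m with R_{v+1} <= 0 < R_v;
        -1 <= v <= m  iff  -1 <= v /\ 0 < s_v *)
   \/ (exists v, -1 <= v /\ 0 < s_ a d c v /\
         R_ a d c k (v + 1) <= 0 < R_ a d c k v /\
         s_ a d c v mod k = 3 mod k /\ s_ a d c (v + 1) = 1 /\
         P_ a d c (v + 1) = P_ a d c v + 1 /\ R_ a d c k v = 3)
   \/ (exists v, -1 <= v /\ 0 < s_ a d c v /\
         R_ a d c k (v + 1) <= 0 < R_ a d c k v /\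
         s_ a d c v mod k = 1 mod k /\ s_ a d c (v + 1) = 2 * k - 1 /\
         P_ a d c (v + 1) = P_ a d c v + 1 /\ R_ a d c k v = 1)
     (* (e), (f): require m >= 0, i.e. s_0 <> 0, so that s_1 and R_1 are defined *)
   \/ (s_ a d c 0 <> 0 /\ s_ a d c 0 mod k = 2 mod k /\
         s_ a d c 0 = s_ a d c 1 + 1 /\ R_ a d c k 1 = 1 - 2 * k)
   \/ (s_ a d c 0 <> 0 /\ s_ a d c 0 mod k = 2 mod k /\
         s_ a d c 0 = s_ a d c 1 + 3 /\ R_ a d c k 1 = -1))).
Proof.
  assert (hk0 : 0 < k) by lia.
  rewrite (pseudo_symmetric_iff _ (SG a d c k)) by (intros x; apply InSG_gens; exact hk).
  split.
  - intros (h & HP).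
    pose proof (PSym_coprime _ _ _ _ _ ha hd hc hk hgcd HP) as Hg.
    split; [exact Hg|].
    destruct (index_exists a d c k ha hd hc hk0 Hg) as (v & Hv & Hs & HR).
    destruct (index_basis a d c k v ha Hg Hv Hs HR) as (D & E & HB & ER & ET).
    destruct (PSym_cases _ _ _ _ _ _ _ _ _ _ _ ha hd hc hk hgcd HB HP)
      as [H | [H | [(Eq & [[Et E3] | [Et E1]]) | (Ep & (m & Em) & H)]]].
    + left. intros x. rewrite InSG_gens, InSG_three by exact hk. apply H.
    + right; left; exact H.
    + right; right; left. exists v.
      repeat (split; [assumption || lia|]). split; [|split; [assumption|split; [assumption|lia]]].
      apply (mod_eq_intro _ _ _ (- D)); lia.
    + right; right; right; left. exists v.
      repeat (split; [assumption || lia|]). split; [|split; [assumption|split; [assumption|lia]]].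
      apply (mod_eq_intro _ _ _ (- D)); lia.
    + destruct (index_data a d c k v ha Hg Hv Hs) as (_ & _ & _ & HvP & _).
      assert (v = 0).
      (* [P] is [0] at index [-1], and [v + 1 <= P_v = 1] excludes positive indices. *)
      { destruct (Z.eq_dec v (-1)) as [-> | ]; [discriminate Ep | lia]. }
      subst v. change (0 + 1) with 1 in *.
      assert (Hmod : s_ a d c 0 mod k = 2 mod k) by (apply (mod_eq_intro _ _ _ m); lia).
      right; right; right; right.
      destruct H as [[H1 H2] | [H1 H2]]; [left | right]; repeat split; try assumption; lia.
  - intros (Hg & [Ha | [[Hb1 Hb2] | [Hc | [Hd | [He | Hf]]]]]).
    + assert (Hiff : forall x, SG a d c k x <-> SG 3 d 3 2 x).
      { intros x. rewrite <- (InSG_gens a d c k), Ha, InSG_three by exact hk. reflexivity. }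
      exists d. apply (PSym_ext (SG 3 d 3 2)); [intros x; symmetry; apply Hiff|].
      apply PSym_case_a; [exact hd|].
      (* If [3] divided [d], all elements of the semigroup would be multiples of [3], against the
         gcd hypothesis. *)
      destruct (Zdivide_dec 3 d) as [H3 | N3].
      * exfalso.
        assert (Hall : forall x, SG a d c k x -> (3 | x)).
        { intros x Hx. apply Hiff in Hx as (n & j & y & _ & _ & ->).
          apply Z.divide_add_r; [apply Z.divide_add_r|].
          - apply Z.divide_factor_r.
          - apply Z.divide_mul_r; exact H3.
          - apply Z.divide_factor_r. }
        assert (Hda : (3 | a)) by (apply Hall; exists 1, 0, 0; lia).
        assert (Hdc : (3 | c)) by (apply Hall, SG_c).
        apply (gens_common_divisor a d c k 3) in hgcd; try assumption; [|lia].
        apply Z.divide_1_r in hgcd. lia.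
      * apply Zgcd_1_rel_prime, prime_rel_prime; [exact prime_3 | exact N3].
    + exists d. apply PSym_case_b; assumption.
    + destruct Hc as (v & Hv & Hs & HR & _ & Et & Eq & E3).
      destruct (index_basis a d c k v ha Hg Hv Hs HR) as (D & E & HB & ER & ET).
      apply (PSym_case_c _ _ _ _ _ _ _ _ _ _ hd hc hk HB); lia.
    + destruct Hd as (v & Hv & Hs & HR & _ & Et & Eq & E3).
      destruct (index_basis a d c k v ha Hg Hv Hs HR) as (D & E & HB & ER & ET).
      apply (PSym_case_d _ _ _ _ _ _ _ _ _ _ hd hc hk HB); lia.
    + destruct He as (Hs & Hmod & Es & ER1).
      destruct (index_data a d c k (-1) ha Hg ltac:(lia) ha) as (Hs1 & _).
      simpl in Hs1. assert (Hs0 : 0 < s_ a d c 0) by lia.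
      destruct (index_data a d c k 0 ha Hg ltac:(lia) Hs0)
        as (H1 & H2 & H3 & _ & D & E & HD & HE & ER & ET). change (0 + 1) with 1 in *.
      rewrite P_0 in *. destruct (mod_eq_elim _ _ _ hk0 Hmod) as [m Hm].
      assert (HR : 0 < R_ a d c k 0).
      { rewrite ER. apply (first_R_pos a d c k _ _ _ _ _ m ha hd hk Hs0 (proj2 H2) H3 HD HE Hm); nia. }
      assert (HR' : R_ a d c k (0 + 1) <= 0 < R_ a d c k 0) by (change (0 + 1) with 1; lia).
      destruct (index_basis a d c k 0 ha Hg ltac:(lia) Hs0 HR') as (D' & E' & HB & ER' & ET').
      change (0 + 1) with 1 in *.
      apply (PSym_case_e _ _ _ _ _ _ _ _ _ _ m hd hc hk HB); (apply P_0 || lia).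
    + destruct Hf as (Hs & Hmod & Es & ER1).
      destruct (index_data a d c k (-1) ha Hg ltac:(lia) ha) as (Hs1 & _).
      simpl in Hs1. assert (Hs0 : 0 < s_ a d c 0) by lia.
      destruct (index_data a d c k 0 ha Hg ltac:(lia) Hs0)
        as (H1 & H2 & H3 & _ & D & E & HD & HE & ER & ET). change (0 + 1) with 1 in *.
      rewrite P_0 in *. destruct (mod_eq_elim _ _ _ hk0 Hmod) as [m Hm].
      assert (HR : 0 < R_ a d c k 0).
      { rewrite ER. apply (first_R_pos a d c k _ _ _ _ _ m ha hd hk Hs0 (proj2 H2) H3 HD HE Hm); nia. }
      assert (HR' : R_ a d c k (0 + 1) <= 0 < R_ a d c k 0) by (change (0 + 1) with 1; lia).
      destruct (index_basis a d c k 0 ha Hg ltac:(lia) Hs0 HR') as (D' & E' & HB & ER' & ET').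
      change (0 + 1) with 1 in *.
      apply (PSym_case_f _ _ _ _ _ _ _ _ _ _ m hd hc hk HB); (apply P_0 || lia).
Qed.
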